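(* Let $l\ge m\ge2$ be integers, $d=\gcd(l,m)$, $\gamma=(m/d,l/d)$, $\chi=(lm-l-m)/d$, and fix a sign $\pm$. Given any formal system $\dot x=(\pm x_2^{m-1},\ x_1^{l-1})+\mathcal X(x)$ with $\mathrm{ord}_\gamma\mathcal X\ge\chi+1$, there exists a near-identity formal transformation $x=y+\mathcal Q(y)$, $\mathrm{ord}_\gamma\mathcal Q\ge1$, that brings it into the generalized normal form (GNF) $$\begin{aligned}\dot y_1={}&\pm y_2^{m-1}+\sum_{j=1}^{m-2}y_2^{j-1}\Bigl(\sum_{\substack{i\not\equiv0,-1\ \mathrm{mod}\ l\\ i>l(1-j/m)}}Y_1^{(i,j-1)}y_1^i+\sum_{r=1+\theta[m-jl]}^\infty Y_1^{(rl-1,j-1)}y_1^{rl-1}+\sum_{s=1}^\infty Y_1^{(sl,j-1)}y_1^{sl}\Bigr)\\&+\sum_{\substack{i\not\equiv0\ \mathrm{mod}\ l\\ i>l/m}}Y_1^{(i,m-2)}y_1^iy_2^{m-2},\end{aligned}$$ $$\begin{aligned}\dot y_2={}&y_1^{l-1}+\sum_{j=1}^{m-2}y_2^{j}\Bigl(\sum_{\substack{i\not\equiv0,-1\ \mathrm{mod}\ l\\ i>l(1-j/m)}}Y_2^{(i-1,j)}y_1^{i-1}+\sum_{r=1+\theta[m-jl]}^\infty Y_2^{(rl-2,j)}y_1^{rl-2}+\sum_{s=1}^\infty Y_2^{(sl-1,j)}y_1^{sl-1}\Bigr)\\&+\sum_{\substack{i\not\equiv0,-1\ \mathrm{mod}\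 l\\ i>l}}Y_2^{(i-1,0)}y_1^{i-1}+\sum_{\substack{i\not\equiv0\ \mathrm{mod}\ l\\ i>l/m}}Y_2^{(i-1,m-1)}y_1^{i-1}y_2^{m-1},\end{aligned}$$ where for each $i\not\equiv0\ \mathrm{mod}\ l$ with $i>l/m$, each $j=1,\dots,m-2$, each $r\ge1+\theta[m-jl]$ and each $s\ge1$, we take either $Y_1^{(i,m-2)}=0$ or $Y_2^{(i-1,m-1)}=0$, either $Y_1^{(rl-1,j-1)}=0$ or $Y_2^{(rl-2,j)}=0$, and either $Y_1^{(sl,j-1)}=0$ or $Y_2^{(sl-1,j)}=0$ (each choice being arbitrary), except that in the case $l=m$, for $j=m-2$, we take $Y_1^{(sm,m-3)}=0$ in the pairs $\{Y_1^{(sm,m-3)},Y_2^{(sm-1,m-2)}\}$.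
   Context: Scalars are in $\mathbb K=\mathbb R$ or $\mathbb C$. For $k\in\mathbb Z$, $\theta[k]=0$ if $k<0$ and $\theta[k]=1$ if $k\ge0$. With weight $\gamma=(\gamma_1,\gamma_2)$ (coprime positive integers), the generalized degree of $x_1^{p_1}x_2^{p_2}$ is $p_1\gamma_1+p_2\gamma_2$. A vector polynomial $(P_1,P_2)$ is a vector quasi-homogeneous polynomial of generalized degree $k$ if $P_i$ is a linear combination of monomials of generalized degree $k+\gamma_i$, $i=1,2$; $\mathfrak V_\gamma^{[k]}$ is the space of these. Vector formal series are taken in the form $\mathcal P=\sum_{k\ge0}\mathcal P_\gamma^{[k]}$ with $\mathcal P_\gamma^{[k]}\in\mathfrak V_\gamma^{[k]}$, and $\mathrm{ord}_\gamma\mathcal P$ is the least $k$ with $\mathcal P_\gamma^{[k]}\not\equiv0$ ($+\infty$ for the zero series). Vector polynomials are identified with vector fields: $\mathcal P(f)=P_1\partial_1f+P_2\partial_2f$ and $[\mathcal P,\mathcal Q]=(\mathcal P(Q_1)-\mathcal Q(P_1),\mathcal P(Q_2)-\mathcal Q(P_2))$. $Y_i^{(p_1,p_2)}$ is the coefficient of $y_1^{p_1}y_2^{p_2}$ in the perturbation component $Y_i$; empty sums are zero; all summation indices are integers. Generalized normal form. Let $\mathcal H$ be the unperturbed part (of generalized degree $\chi$). For $k\ge1$ let $n_k=\dim\mathfrak V_\gamma^{[k+\chi]}-\dim[\mathcal H,\mathfrak V_\gamma^{[k]}]$, and let $\mathbf a_1^k,\dots,\mathbf a_{n_k}^k$ be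 the coefficient vectors (in the standard monomial basis of $\mathfrak V_\gamma^{[k+\chi]}$) of the $n_k$ linearly independent linear conditions (resonance equations) for solvability of the homological equation $[\mathcal H,\mathcal Q_\gamma^{[k]}]=\widetilde{\mathcal Y}_\gamma^{[k+\chi]}-\mathcal Y_\gamma^{[k+\chi]}$ in $\mathcal Q_\gamma^{[k]}\in\mathfrak V_\gamma^{[k]}$, i.e. a basis of the orthogonal complement of the image $[\mathcal H,\mathfrak V_\gamma^{[k]}]$. A resonant set consists, for each $k\ge1$, of $n_k$ coefficients of $\mathcal Y_\gamma^{[k+\chi]}$, at positions $l_1,\dots,l_{n_k}$, such that $\det(\mathbf a^k_{i,l_j})_{i,j=1}^{n_k}\neq0$. The system $\dot y=\mathcal H(y)+\mathcal Y(y)$, $\mathrm{ord}_\gamma\mathcal Y\ge\chi+1$, is a GNF if all coefficients of $\mathcal Y$ are zero except for those from some resonant set, which have arbitrary values. Thus the claim that the displayed system is a GNF means that, for each choice made, the coefficients remaining in it form a resonant set.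
   Formalization: The case l = m = 2 is excluded: there χ = 0, H = (±x₂, x₁) is linear and n₂ = 2, but the displayed form keeps only one coefficient of degree 2 (Y₁^(3,0) or Y₂^(2,1)), so the claim is false for this pair. *)

(* Defs.v *)
From HB Require Import structures.
From mathcomp Require Import all_boot all_order all_algebra.
From mathcomp Require Import reals.
From mathcomp Require Import complex.

Set Implicit Arguments.
Unset Strict Implicit.
Unset Printing Implicit Defensive.

Import Order.TTheory GRing.Theory Num.Theory.
Local Open Scope ring_scope.
Local Open Scope complex_scope.

Variant real_or_complex (R : realType) : fieldType -> Prop :=
| RealScalars : real_or_complex R R
| ComplexScalars : real_or_complex R R[i].

Definition theta (k : int) : nat := (0 <= k)%R.

Definition c1 : 'I_2 := ord0.
Definition c2 : 'I_2 := ord_max.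
Definition vec2 (T : Type) (a b : T) : 'I_2 -> T :=
  fun i => if i == c1 then a else b.

(* [f p q] is the coefficient of x_1^p x_2^q. Series and vector series are
   always compared coefficientwise. *)
Definition series (K : Type) := nat -> nat -> K.
Definition vseries (K : Type) := 'I_2 -> series K.

Definition smonomial (K : fieldType) (c : K) (p q : nat) : series K :=
  fun a b => if (a == p) && (b == q) then c else 0.

Definition sadd (K : fieldType) (f g : series K) : series K :=
  fun a b => f a b + g a b.

Definition smul (K : fieldType) (f g : series K) : series K :=
  fun a b => \sum_(i < a.+1) \sum_(j < b.+1) f i j * g (a - i)%N (b - j)%N.

Definition spow (K : fieldType) (f : series K) (n : nat) : series K :=
  iter n (smul f) (smonomial 1 0 0).

Definition spartial (K : fieldType) (i : 'I_2) (f : series K) : series K :=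
  fun a b => if i == c1 then f a.+1 b *+ a.+1 else f a b.+1 *+ b.+1.

(* [f(g_1, g_2)], for [g_1] and [g_2] without constant term: then
   g_1^p g_2^q only has terms of total degree at least p + q, so that the
   finite sum below is the full coefficient of x_1^a x_2^b. *)
Definition scomp (K : fieldType) (f : series K) (g : vseries K) : series K :=
  fun a b => \sum_(p < (a + b).+1) \sum_(q < (a + b).+1)
    f p q * smul (spow (g c1) p) (spow (g c2) q) a b.

Definition vadd (K : fieldType) (P Q : vseries K) : vseries K :=
  fun i => sadd (P i) (Q i).

Definition videntity (K : fieldType) : vseries K :=
  vec2 (smonomial 1 1 0) (smonomial 1 0 1).

(* P(f) = P_1 d_1 f + P_2 d_2 f. *)
Definition vapply (K : fieldType) (P : vseries K) (f : series K) : series K :=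
  fun a b => \sum_(i < 2) smul (P i) (spartial i f) a b.

(* [P, Q]_i = P(Q_i) - Q(P_i). *)
Definition bracket (K : fieldType) (P Q : vseries K) : vseries K :=
  fun i a b => vapply P (Q i) a b - vapply Q (P i) a b.

(* The substitution x = y + Q(y) turns the system x' = F(x) into y' = G(y):
   differentiating x_i = y_i + Q_i(y) along y' = G(y) gives the derivation G
   applied to y_i + Q_i, which has to be F_i(y + Q(y)). *)
Definition transforms (K : fieldType) (F Q G : vseries K) : Prop :=
  let x := vadd (videntity K) Q in
  forall i a b, scomp (F i) x a b = vapply G (x i) a b.

Definition gdegree (g : 'I_2 -> nat) (p : nat * nat) : nat :=
  (p.1 * g c1 + p.2 * g c2)%N.

(* ord_g P >= n. Since [n] is a natural number this includes the convention
   that P has no quasi-homogeneous part of negative generalized degree. *)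
Definition ord_ge (K : fieldType) (g : 'I_2 -> nat) (P : vseries K) (n : nat) :
    Prop :=
  forall i a b, (gdegree g (a, b) < n + g i)%N -> P i a b = 0.

(* The position (i, (p, q)) stands for the coefficient of x_1^p x_2^q in the
   i-th component, i.e. for the corresponding monomial vector field. *)
Definition position : Type := ('I_2 * (nat * nat))%type.

Definition coefficient (K : fieldType) (P : vseries K) (p : position) : K :=
  P p.1 p.2.1 p.2.2.

Definition monomial_field (K : fieldType) (p : position) : vseries K :=
  fun i => if i == p.1 then smonomial 1 p.2.1 p.2.2 else fun _ _ => 0.

(* For positive weights, exponents in a monomial of generalized degree n are
   at most n, so this lists all of them, without repetition. *)
Definition monomials (g : 'I_2 -> nat) (n : nat) : seq (nat * nat) :=
  [seq p <- [seq (a, b) | a <- iota 0 n.+1, b <- iota 0 n.+1]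
     | gdegree g p == n].

(* The standard monomial basis of the space V_g^[k] of vector
   quasi-homogeneous polynomials of generalized degree k. *)
Definition qhbasis (g : 'I_2 -> nat) (k : nat) : seq position :=
  [seq (i, p) | i <- enum 'I_2, p <- monomials g (k + g i)].

Definition qhdim (g : 'I_2 -> nat) (k : nat) : nat := size (qhbasis g k).

Definition qhbasis_nth (g : 'I_2 -> nat) (k : nat) (i : 'I_(qhdim g k)) :
  position := tnth (in_tuple (qhbasis g k)) i.

(* The rows are the coordinates in V_g^[k + chi] of [H, e], with e running
   through the basis of V_g^[k]; the row space is thus [H, V_g^[k]]. *)
Definition homological_mx (K : fieldType) (g : 'I_2 -> nat) (chi : nat)
    (H : vseries K) (k : nat) : 'M[K]_(qhdim g k, qhdim g (k + chi)) :=
  \matrix_(i, j) coefficient (bracket H (monomial_field K (qhbasis_nth i)))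
                             (qhbasis_nth j).

Definition nres (K : fieldType) (g : 'I_2 -> nat) (chi : nat)
    (H : vseries K) (k : nat) : nat :=
  (qhdim g (k + chi) - \rank (homological_mx g chi H k))%N.

(* The rows of A form a basis of the orthogonal complement of [H, V_g^[k]] for
   the bilinear dot product: the w in [H, V_g^[k]] are exactly the solutions of
   the linear conditions whose coefficient vectors are the rows of A. *)
Definition resonance_equations (K : fieldType) (g : 'I_2 -> nat) (chi : nat)
    (H : vseries K) (k : nat)
    (A : 'M[K]_(nres g chi H k, qhdim g (k + chi))) : Prop :=
  row_free A /\ (A :=: kermx (homological_mx g chi H k)^T)%MS.

(* [t] is the list of positions l_1, ..., l_{n_k}. Changing the basis A
   multiplies the determinant by a nonzero scalar, so quantifying over all A
   amounts to fixing one. *)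
Definition resonant_set (K : fieldType) (g : 'I_2 -> nat) (chi : nat)
    (H : vseries K) (S : position -> Prop) : Prop :=
  (forall p, S p -> exists2 k, (1 <= k)%N & p \in qhbasis g (k + chi)) /\
  forall k, (1 <= k)%N ->
    exists t : 'I_(nres g chi H k) -> 'I_(qhdim g (k + chi)),
      (forall q, S (qhbasis_nth q) <-> exists j, t j = q) /\
      (forall A : 'M[K]_(nres g chi H k, qhdim g (k + chi)),
         resonance_equations A ->
         \det (\matrix_(i < nres g chi H k, j < nres g chi H k) A i (t j)) != 0).

Definition weight (l m : nat) : 'I_2 -> nat :=
  vec2 (m %/ gcdn l m)%N (l %/ gcdn l m)%N.

(* The subtraction does not truncate for l, m >= 2, and the division is
   exact. *)
Definition chi (l m : nat) : nat := ((l * m - l - m) %/ gcdn l m)%N.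

(* The sign is + for [minus = false] and - for [minus = true]. *)
Definition unperturbed (K : fieldType) (l m : nat) (minus : bool) : vseries K :=
  vec2 (smonomial ((-1) ^+ minus) 0 (m - 1)) (smonomial 1 (l - 1) 0).

(* In each pair of coefficients, the component of the one taken to be zero:
   - [zero_i i]   for {Y_1^(i,m-2),    Y_2^(i-1,m-1)};
   - [zero_r j r] for {Y_1^(rl-1,j-1), Y_2^(rl-2,j)};
   - [zero_s j s] for {Y_1^(sl,j-1),   Y_2^(sl-1,j)}. *)
Record choices := Choices {
  zero_i : nat -> 'I_2;
  zero_r : nat -> nat -> 'I_2;
  zero_s : nat -> nat -> 'I_2
}.

Definition admissible (l m : nat) (c : choices) : Prop :=
  l = m -> (1 <= m - 2)%N -> forall s, (1 <= s)%N -> zero_s c (m - 2) s = c1.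

(* The coefficients remaining in the normal form, sum by sum; i > l(1 - j/m)
   and i > l/m are written without denominators. *)
Inductive remaining (l m : nat) (c : choices) : position -> Prop :=
| Rem1_i i j of (1 <= j <= m - 2)%N & ~~ (l %| i)%N & ~~ (l %| i + 1)%N
    & (l * (m - j) < m * i)%N :
    remaining l m c (c1, (i, j - 1)%N)
| Rem1_r r j of (1 <= j <= m - 2)%N & (1 + theta (m%:Z - j%:Z * l%:Z) <= r)%N
    & zero_r c j r != c1 :
    remaining l m c (c1, (r * l - 1, j - 1)%N)
| Rem1_s s j of (1 <= j <= m - 2)%N & (1 <= s)%N & zero_s c j s != c1 :
    remaining l m c (c1, (s * l, j - 1)%N)
| Rem1_last i of ~~ (l %| i)%N & (l < m * i)%N & zero_i c i != c1 :
    remaining l m c (c1, (i, m - 2)%N)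
| Rem2_i i j of (1 <= j <= m - 2)%N & ~~ (l %| i)%N & ~~ (l %| i + 1)%N
    & (l * (m - j) < m * i)%N :
    remaining l m c (c2, (i - 1, j)%N)
| Rem2_r r j of (1 <= j <= m - 2)%N & (1 + theta (m%:Z - j%:Z * l%:Z) <= r)%N
    & zero_r c j r != c2 :
    remaining l m c (c2, (r * l - 2, j)%N)
| Rem2_s s j of (1 <= j <= m - 2)%N & (1 <= s)%N & zero_s c j s != c2 :
    remaining l m c (c2, (s * l - 1, j)%N)
| Rem2_first i of ~~ (l %| i)%N & ~~ (l %| i + 1)%N & (l < i)%N :
    remaining l m c (c2, (i - 1, 0)%N)
| Rem2_last i of ~~ (l %| i)%N & (l < m * i)%N & zero_i c i != c2 :
    remaining l m c (c2, (i - 1, m - 1)%N).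

(* Main.v *)
Require Import Defs.
From HB Require Import structures.
From mathcomp Require Import all_boot all_order all_algebra.
From mathcomp Require Import reals.
From mathcomp Require Import complex.
From mathcomp Require Import boolp ring zify.

Set Implicit Arguments.
Unset Strict Implicit.
Unset Printing Implicit Defensive.

Import Order.TTheory GRing.Theory Num.Theory.
Local Open Scope ring_scope.

(* A linear functional vanishing on the image of [H, -] has a value U(i, j) at
   x_1^i x_2^(j-1) in the first component and V(i, j) at x_1^(i-1) x_2^j in the
   second one.  The resonance equations only relate (i, j) to (i - l, j + m), so
   they split into chains i = x + a l, j = y + (T - a) m with x < l, y < m and
   0 <= a <= T.  On a chain they determine everything from the pair (u_T, v_T) at
   the bottom j = y, and depending on whether x is 0 or l - 1 and y is 0 or
   m - 1, that pair is free, confined to a line, or zero.  Lines occur with a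
   slope that is neither zero nor infinite: for x = l - 1 or y = m - 1 the slope is
   explicit; for x = 0 the values on the Hamiltonian fields keep one sign and
   those on the Euler fields take the opposite one, which forces
   u_T and v_T to be nonzero.  Hence the remaining coefficients form a resonant
   set, also in the case l = m, j = m - 2 with either choice.
   The normalizing transformation is built degree by degree: adding q of order
   k to Q and w of order chi + k to Y changes the residual of the conjugacy
   equation by -[H, q] - w up to terms of order chi + k + 1. *)

(** * Resonance equations along a chain *)

(* [u a] and [v a] stand for (- sign)^a U(i, j) and (- sign)^a V(i, j) at the
   point i = x + a l, j = y + (T - a) m; the factor absorbs the sign of H. *)
Record chain (K : numFieldType) (l m x y T : nat) (u v : nat -> K) : Prop :=
  Chain {
  chain_u : forall a, (a < T)%N -> (y + (T - a.+1) * m)%:R * u a.+1 =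
    (l%:R - 1) * v a.+1 + (x + a * l + 1)%:R * u a;
  chain_v : forall a, (a < T)%N -> (y + (T - a.+1) * m + 1)%:R * v a.+1 =
    (x + a * l)%:R * v a - (m%:R - 1) * u a;
  chain_top : x.+1 = l -> (y + T * m)%:R * u 0%N = (l%:R - 1) * v 0%N;
  chain_bot : y.+1 = m -> (x + T * l)%:R * v T = (m%:R - 1) * u T;
  chain_v0 : x = 0%N -> v 0%N = 0;
  chain_uT : y = 0%N -> u T = 0
}.

Section Chains.
Context (K : numFieldType) (l m x y T : nat).
Implicit Types u v : nat -> K.
Context (l_gt1 : (1 < l)%N).
Context (m_gt1 : (1 < m)%N).

Let nz (n : nat) : (0 < n)%N -> n%:R != 0 :> K.
Proof. by rewrite pnatr_eq0 lt0n. Qed.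

(** Going from the bottom index [T] to the top index 0, [chain_u] gives [u a] and then [chain_v]
    gives [v a]. The coefficient of [v a] vanishes only at x = a = 0, where [chain_v0] takes
    over. *)
Lemma chain_det_bot u v : chain l m x y T u v -> u T = 0 -> v T = 0 ->
  forall a, (a <= T)%N -> u a = 0 /\ v a = 0.
Proof.
move=> ch uT vT a le_aT; rewrite -(subKn le_aT).
elim: (T - a)%N (leq_subr a T) => [|d IH] ltd; first by rewrite subn0.
have [] := IH (ltnW ltd); have -> : (T - d = (T - d.+1).+1)%N by lia.
set b := (T - d.+1)%N => ub vb; have bT : (b < T)%N by lia.
have := chain_u ch bT; rewrite ub vb !mulr0 add0r => /esym /eqP.
rewrite mulf_eq0 (negPf (nz _)) /= ?addn1 // => /eqP u0; split=> //.
have := chain_v ch bT; rewrite u0 vb !mulr0 subr0 => /esym /eqP.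
rewrite mulf_eq0 pnatr_eq0 => /orP[|/eqP //].
rewrite addn_eq0 muln_eq0 => /andP[/eqP x0 b0].
by have -> : b = 0%N; [lia | apply: chain_v0 ch x0].
Qed.

(* Up to sign, the value j U - i V of the functional on the Hamiltonian field of
   x_1^i x_2^j. *)
Definition defect u v (a : nat) : K :=
  (y + (T - a) * m)%:R * u a - (x + a * l)%:R * v a.

Lemma defectE u v a : chain l m x y T u v -> (a < T)%N ->
  defect u v a = (y + (T - a.+1) * m + 1)%:R * (u a - v a.+1).
Proof.
move=> ch aT; have := chain_v ch aT; rewrite /defect.
have -> : (T - a = (T - a.+1).+1)%N by lia.
by move: (T - a.+1)%N => b e; rewrite mulrBr e; ring.
Qed.

Lemma defectSE u v a : chain l m x y T u v -> (a < T)%N ->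
  defect u v a.+1 = (x + a * l + 1)%:R * (u a - v a.+1).
Proof.
by move=> ch aT; rewrite /defect (chain_u ch aT); ring.
Qed.

(** Both [defect u v a] and [defect u v a.+1] are positive integer multiples of [u a - v a.+1], so
    vanishing at one end of the chain spreads to all of it. [defect_bot] (y = m - 1) and
    [defect_top] (x = l - 1) supply such an end. *)
Lemma defect_eq0 u v : chain l m x y T u v ->
  defect u v 0 = 0 \/ defect u v T = 0 ->
  (forall a, (a <= T)%N -> defect u v a = 0) /\
  (forall a, (a < T)%N -> v a.+1 = u a).
Proof.
move=> ch h.
have step a : (a < T)%N -> (defect u v a == 0) = (defect u v a.+1 == 0).
  move=> aT; rewrite (defectE ch aT) (defectSE ch aT) !mulf_eq0.
  by rewrite !(negPf (nz _)) ?addn1.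
have all0 a : (a <= T)%N -> (defect u v a == 0) = (defect u v 0 == 0).
  by elim: a => // a IH aT; rewrite -step // IH // ltnW.
have d0 : defect u v 0 = 0.
  by case: h => // hT; apply/eqP; rewrite -(all0 T) // hT.
have {}all0 a : (a <= T)%N -> defect u v a = 0.
  by move=> /all0; rewrite d0 eqxx => /eqP.
split=> // a aT; have := all0 _ (ltnW aT); rewrite (defectE ch aT) => /eqP.
by rewrite mulf_eq0 (negPf (nz _)) ?addn1 //= subr_eq0 => /eqP.
Qed.

Lemma defect_bot u v : chain l m x y T u v -> y.+1 = m -> defect u v T = 0.
Proof.
move=> ch ym; rewrite /defect (chain_bot ch ym) subnn mul0n addn0 -ym.
by ring.
Qed.

Lemma defect_top u v : chain l m x y T u v -> x.+1 = l -> defect u v 0 = 0.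
Proof.
move=> ch xl; rewrite /defect subn0 (chain_top ch xl) mul0n addn0 -xl.
by ring.
Qed.

(** The chain is built from its bottom pair; 0 < x keeps every divisor nonzero. The last hypothesis
    says that for x = l - 1 the defect vanishes at the bottom. *)
Lemma chain_exists_bot (u0 v0 : K) : (0 < x)%N ->
  (y = 0%N -> u0 = 0) -> (y.+1 = m -> (x + T * l)%:R * v0 = (m%:R - 1) * u0) ->
  (x.+1 = l -> y%:R * u0 = (x + T * l)%:R * v0) ->
  exists u v, [/\ chain l m x y T u v, u T = u0 & v T = v0].
Proof.
move=> x_gt0 hy hm hl.
(* [d] counts from the bottom: [step d] passes from the pair at index T - d to the pair at b = T - d
   - 1. *)
pose step (d : nat) (p : K * K) :=
  let b := (T - d.+1)%N in
  let u := ((y + d * m)%:R * p.1 - (l%:R - 1) * p.2) / (x + b * l + 1)%:R in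
  (u, ((y + d * m + 1)%:R * p.2 + (m%:R - 1) * u) / (x + b * l)%:R).
pose p := fix p d := if d is d'.+1 then step d' (p d') else (u0, v0).
pose u a := (p (T - a)%N).1; pose v a := (p (T - a)%N).2.
have uT : u T = u0 by rewrite /u subnn.
have vT : v T = v0 by rewrite /v subnn.
have nzx b : (x + b * l)%:R != 0 :> K by apply: nz; rewrite addn_gt0 x_gt0.
have nzx1 b : (x + b * l + 1)%:R != 0 :> K by apply: nz; rewrite addn1.
have pE a : (a < T)%N -> p (T - a)%N = step (T - a.+1)%N (p (T - a.+1)%N).
  by move=> aT; have -> : (T - a = (T - a.+1).+1)%N by lia.
have chu a : (a < T)%N -> (y + (T - a.+1) * m)%:R * u a.+1 =
    (l%:R - 1) * v a.+1 + (x + a * l + 1)%:R * u a.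
  move=> aT; rewrite /u (pE a aT) /step /=.
  have -> : (T - (T - a.+1).+1 = a)%N by lia.
  by rewrite mulrC -/(u _) -/(v _) [X in _ = _ + X]mulrC divfK // addrC mulrC subrK.
have chv a : (a < T)%N -> (y + (T - a.+1) * m + 1)%:R * v a.+1 =
    (x + a * l)%:R * v a - (m%:R - 1) * u a.
  move=> aT; rewrite /u {2}/v (pE a aT) /step /=.
  have -> : (T - (T - a.+1).+1 = a)%N by lia.
  by rewrite [X in _ = X - _]mulrC divfK // addrK.
exists u, v; split=> //; split=> //; last 3 first.
- by move=> ym; rewrite uT vT hm.
- by move=> x0; rewrite x0 in x_gt0.
- by move=> y0; rewrite uT hy.
move=> xl.
(* The defect is carried to the top by the recurrences alone, since [defect_eq0] presupposes a full
   [chain], of which [chain_top] is still to be shown. *)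
have dT d : (d <= T)%N -> defect u v (T - d) = 0.
  elim: d => [|d IH] dT.
    by rewrite /defect subn0 subnn mul0n addn0 uT vT hl // subrr.
  have aT : (T - d.+1 < T)%N by lia.
  move: (IH (ltnW dT)); have -> : (T - d = (T - d.+1).+1)%N by lia.
  rewrite /defect chu // => /eqP; set a := (T - d.+1)%N.
  have -> : (l%:R - 1) * v a.+1 + (x + a * l + 1)%:R * u a -
      (x + a.+1 * l)%:R * v a.+1 = (x + a * l + 1)%:R * (u a - v a.+1).
    by ring.
  rewrite mulf_eq0 (negPf (nzx1 _)) /= subr_eq0 => /eqP uv.
  have := chv _ aT; rewrite -/a -uv.
  have -> : (T - a = (T - a.+1).+1)%N by lia.
  move: (T - a.+1)%N => b e; apply/eqP.
  rewrite -(subrr ((y + b * m + 1)%:R * u a)) {2}e; apply/eqP; ring.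
have := dT T (leqnn T); rewrite /defect subnn subn0 mul0n addn0 => /eqP.
by rewrite subr_eq0 -xl => /eqP ->; rewrite -natr1 addrK.
Qed.

(** The recurrences are solved from the top pair (1, 0), whose second entry is imposed by
    [chain_v0]; 0 < y keeps the divisors nonzero. *)
Lemma chain_exists_top : x = 0%N -> (0 < y)%N -> (y.+1 < m)%N ->
  exists u v, chain l m x y T u v /\ u 0%N = 1.
Proof.
move=> x0 y_gt0 ym.
pose step (a : nat) (p : K * K) :=
  let b := (T - a.+1)%N in
  let v := ((x + a * l)%:R * p.2 - (m%:R - 1) * p.1) / (y + b * m + 1)%:R in
  (((l%:R - 1) * v + (x + a * l + 1)%:R * p.1) / (y + b * m)%:R, v).
pose p := fix p a := if a is a'.+1 then step a' (p a') else (1, 0).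
have nzy b : (y + b * m)%:R != 0 :> K by apply: nz; rewrite addn_gt0 y_gt0.
have nzy1 b : (y + b * m + 1)%:R != 0 :> K by apply: nz; rewrite addn1.
exists (fun a => (p a).1), (fun a => (p a).2); split=> //; split=> //=.
- by move=> a aT; rewrite mulrC divfK.
- by move=> a aT; rewrite mulrC divfK.
- by move=> xl; move: l_gt1; rewrite -xl x0.
- by move=> e; move: ym; rewrite e ltnn.
- by move=> e; rewrite e in y_gt0.
Qed.

Lemma chain_scale u v c : chain l m x y T u v ->
  chain l m x y T (fun a => c * u a) (fun a => c * v a).
Proof.
case=> h1 h2 h3 h4 h5 h6; split.
- by move=> a /h1 e; rewrite mulrCA e; ring.
- by move=> a /h2 e; rewrite mulrCA e; ring.
- by move=> /h3 e; rewrite mulrCA e; ring.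
- by move=> /h4 e; rewrite mulrCA e; ring.
- by move=> /h5 ->; rewrite mulr0.
- by move=> /h6 ->; rewrite mulr0.
Qed.

(** Since [v 0 = 0], the recurrences propagate zero to the bottom. The coefficient of [u a.+1]
    vanishes only for y = 0 and a.+1 = T, which [chain_uT] covers. *)
Lemma chain_top_eq0 u v : x = 0%N -> chain l m x y T u v -> u 0%N = 0 ->
  u T = 0 /\ v T = 0.
Proof.
move=> x0 ch u0; have v0 := chain_v0 ch x0.
suff: forall a, (a <= T)%N -> u a = 0 /\ v a = 0 by apply.
elim=> // a IH aT; have [ua va] := IH (ltnW aT).
have := chain_v ch aT; rewrite ua va !mulr0 subr0 => /eqP.
rewrite mulf_eq0 (negPf (nz _)) ?addn1 //= => /eqP v1; split=> //.
have := chain_u ch aT; rewrite ua v1 !mulr0 addr0 => /eqP.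
rewrite mulf_eq0 pnatr_eq0 => /orP[|/eqP //].
rewrite addn_eq0 muln_eq0 => /andP[/eqP y0].
case/orP=> [h|]; last by rewrite eqn0Ngt ltnW.
by have -> : a.+1 = T; [lia | apply: chain_uT ch y0].
Qed.

End Chains.

(** * Signs along the chains with x = 0 *)

Section Signs.
Context (K : numFieldType) (l m y T : nat) (u v : nat -> K).
Context (l_gt1 : (1 < l)%N).
Context (m_gt1 : (1 < m)%N).
Context (lm_gt : (l + m < l * m)%N).
Context (ch : chain l m 0 y T.+1 u v).
Context (u0 : u 0%N = 1).

Let A := defect l m 0 y T.+1 u v.
(* Up to normalization, [A] and [B] are the values of the functional on the
   Hamiltonian and on the Euler fields. *)
Let B a : K := m%:R * u a + l%:R * v a.
Let z a : K := u a - v a.+1.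
Let ch0 : K := (l * m - l - m)%:R.

Let ch0E : ch0 = l%:R * m%:R - l%:R - m%:R.
Proof.
have h1 : (l <= l * m)%N by lia.
have h2 : (m <= l * m - l)%N by lia.
by rewrite /ch0 natrB // natrB // natrM.
Qed.

Let ch0_gt0 : 0 < ch0.
Proof. by rewrite ltr0n; lia. Qed.

Let AE a : (a < T.+1)%N -> A a = (y + (T.+1 - a.+1) * m + 1)%:R * z a.
Proof. exact: defectE. Qed.

Let ASE a : (a < T.+1)%N -> A a.+1 = (0 + a * l + 1)%:R * z a.
Proof. exact: defectSE. Qed.

(** Adding m times [chain_u] to l times [chain_v] gives a recurrence for [B] alone, driven by
    [z]. *)
Let BE a : (a < T.+1)%N -> (y + (T.+1 - a.+1) * m)%:R * B a.+1 =
  (0 + a * l)%:R * B a - ch0 * z a.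
Proof.
move=> aT; rewrite ch0E /B /z; have eu := chain_u ch aT; have ev := chain_v ch aT.
rewrite mulrDr mulrCA eu.
have -> : (y + (T.+1 - a.+1) * m)%:R * (l%:R * v a.+1) =
  l%:R * ((y + (T.+1 - a.+1) * m + 1)%:R * v a.+1) - l%:R * v a.+1 by ring.
by rewrite ev; ring.
Qed.

(** [A] starts positive at the top because u 0 = 1, and [A a] and [A a.+1] are positive multiples of
    the same [z a]. *)
Let z_gt0 a : (a < T.+1)%N -> 0 < z a.
Proof.
have zA b : (b < T.+1)%N -> 0 < A b -> 0 < z b.
  by move=> bT; rewrite AE // pmulr_rgt0 // ltr0n addn1.
elim: a => [|a IH] aT; apply: zA => //.
  rewrite /A /defect u0 mul0n mul0r subr0 mulr1 ltr0n.
  by rewrite addn_gt0 muln_gt0 subn0 (ltnW m_gt1) orbT.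
by rewrite ASE ?mulr_gt0 ?IH 1?ltnW // ltr0n addn1.
Qed.

Let iB_le0 a : (a < T.+1)%N -> (0 + a * l)%:R * B a <= 0.
Proof.
elim: a => [|a IH] aT; first by rewrite mul0r.
have aT' := ltnW aT.
rewrite pmulr_rle0; last by rewrite ltr0n; lia.
have j_gt0 : 0 < (y + (T.+1 - a.+1) * m)%:R :> K.
  by rewrite ltr0n addn_gt0 muln_gt0 subn_gt0 aT /= (ltnW m_gt1) orbT.
rewrite -(pmulr_rle0 _ j_gt0) BE // subr_le0 (le_trans (IH aT')) //.
by rewrite ltW // mulr_gt0 // z_gt0.
Qed.

(** For y = 0 the last instance of [BE] has left side 0, while its right side is a nonpositive term
    minus a positive one. *)
Lemma chain_top1_y0 : y = 0%N -> False.
Proof.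
move=> y0; have := BE (ltnSn T); rewrite subnn mul0n addn0 y0 mul0r => /esym e.
have := iB_le0 (ltnSn T); move/eqP: e; rewrite subr_eq0 => /eqP ->.
by rewrite lt_geF // mulr_gt0 // z_gt0.
Qed.

Context (y_gt0 : (0 < y)%N) (y_lt : (y.+1 < m)%N) (le_ml : (m <= l)%N).

Let x := (0 + T.+1 * l)%N.
Let D_gt0 : 0 < (l * y + m * x)%:R :> K.
Proof. by rewrite ltr0n addn_gt0 muln_gt0 y_gt0 (ltnW l_gt1). Qed.

Let AT : A T.+1 = (x - l + 1)%:R * z T.
Proof. by rewrite ASE //; congr (_%:R * _); rewrite /x; lia. Qed.

Let BT : y%:R * B T.+1 <= - (ch0 * z T).
Proof.
have := BE (ltnSn T); rewrite subnn mul0n addn0 => ->.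
by rewrite gerDr iB_le0.
Qed.

(** Eliminating u between [A] and [B] writes a positive multiple of v as y B - m A, where y B < 0 <
    A. *)
Lemma chain_top1_v : v T.+1 != 0.
Proof.
rewrite -(mulrI_eq0 _ (lregP (lt0r_neq0 D_gt0))).
have -> : (l * y + m * x)%:R * v T.+1 = y%:R * B T.+1 - m%:R * A T.+1.
  by rewrite /A /B /defect /x subnn mul0n addn0; ring.
rewrite lt_eqF // subr_lt0 (le_lt_trans BT) // (@lt_trans _ _ 0) //.
  by rewrite oppr_lt0 mulr_gt0 // z_gt0.
by rewrite AT !mulr_gt0 ?z_gt0 ?ltr0n ?addn1 // ltnW.
Qed.

(** Elimination now gives l y A + x (y B), with terms of opposite signs; [AT] and [BT] bound it by
    (l y (x - l + 1) - x ch0) z. This is negative because l y <= l (m - 2) <= ch0, the last by m <=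
    l, and x - l + 1 < x. *)
Lemma chain_top1_u : u T.+1 != 0.
Proof.
rewrite -(mulrI_eq0 _ (lregP (lt0r_neq0 D_gt0))).
rewrite -(mulrI_eq0 _ (lregP (_ : y%:R != 0 :> K))); last first.
  by rewrite pnatr_eq0 -lt0n.
have -> : y%:R * ((l * y + m * x)%:R * u T.+1) =
    (l * y)%:R * A T.+1 + x%:R * (y%:R * B T.+1).
  by rewrite /A /B /defect /x subnn mul0n addn0; ring.
have x_gt0 : 0 < x%:R :> K by rewrite ltr0n /x; lia.
rewrite lt_eqF // AT.
apply: (@le_lt_trans _ _ (((l * y * (x - l + 1))%:R - x%:R * ch0) * z T)).
  rewrite (natrM _ (l * y)) mulrBl -mulrA -(mulrA x%:R) lerD2l -mulrN.
  by rewrite ler_pM2l.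
rewrite pmulr_llt0 ?z_gt0 // /ch0 -natrM subr_lt0 ltr_nat.
apply: (@leq_trans (l * y * x)%N).
  by rewrite ltn_pmul2l ?muln_gt0 ?y_gt0 ?(ltnW l_gt1) // /x; lia.
rewrite mulnC leq_mul2l; apply/orP; right.
have : (l * y <= l * (m - 2))%N by rewrite leq_mul2l; apply/orP; right; lia.
by rewrite mulnBr; lia.
Qed.

End Signs.

(** * Remaining coefficients *)

(* [slot1 i j] and [slot2 i j]: the positions of x_1^i x_2^(j-1) in the first
   component and of x_1^(i-1) x_2^j in the second one remain. *)
Definition slot1 (l m : nat) (c : choices) (i j : nat) : bool :=
  [&& (0 < j < m)%N, (l * m < m * i + l * j)%N &
    if j.+1 == m then ~~ (l %| i)%N && (zero_i c i != c1)
    else if (l %| i)%N then zero_s c j (i %/ l)%N != c1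
    else if (l %| i.+1)%N then zero_r c j (i.+1 %/ l)%N != c1 else true].

Definition slot2 (l m : nat) (c : choices) (i j : nat) : bool :=
  [&& (j < m)%N, (l * m < m * i + l * j)%N &
    if j == 0%N then ~~ (l %| i)%N && ~~ (l %| i.+1)%N
    else if j.+1 == m then ~~ (l %| i)%N && (zero_i c i != c2)
    else if (l %| i)%N then zero_s c j (i %/ l)%N != c2
    else if (l %| i.+1)%N then zero_r c j (i.+1 %/ l)%N != c2 else true].

Definition slot (l m : nat) (c : choices) (p : position) : bool :=
  if p.1 == c1 then slot1 l m c p.2.1 p.2.2.+1 else slot2 l m c p.2.1.+1 p.2.2.

Lemma neq_c1_c2 (k : 'I_2) : (k != c1) || (k != c2).
Proof. by case: k => [[|[|]]]. Qed.

Lemma I2_cases (k : 'I_2) : k = c1 \/ k = c2.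
Proof.
case: k => [[|[|//]] h]; [left | right]; exact: val_inj.
Qed.

Section Slots.
Context (l m : nat) (c : choices).
Context (m_gt1 : (1 < m)%N) (le_ml : (m <= l)%N) (l_gt2 : (2 < l)%N).

Let levelE i j : (j <= m)%N ->
  (l * (m - j) < m * i)%N = (l * m < m * i + l * j)%N.
Proof. by move=> jm; rewrite mulnBr ltn_subLR ?leq_mul2l ?jm ?orbT // addnC. Qed.

Let dvd_succ i : (l %| i)%N -> (l %| i.+1)%N = false.
Proof. by move=> d; rewrite -addn1 dvdn_addr // dvdn1; lia. Qed.

(** For r = 1 the inequality reads m < l j, which is the vanishing of theta; for r >= 2 both sides
    hold. *)
Let theta_level r j : (0 < r)%N -> (0 < j < m)%N ->
  (1 + theta (m%:Z - j%:Z * l%:Z) <= r)%N =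
  (l * m < m * (r * l - 1) + l * j)%N.
Proof.
move=> r_gt0 jm; rewrite /theta mulnBr muln1 subr_ge0.
have -> : (j%:Z * l%:Z <= m%:Z)%R = (l * j <= m)%N by rewrite -PoszM lez_nat mulnC.
case: r r_gt0 => [//|r] _; rewrite mulSn mulnDr.
have h1 : (0 < m * l)%N by rewrite muln_gt0; lia.
have h2 : (m <= m * l)%N by rewrite leq_pmulr //; lia.
rewrite (mulnC l m); case: r => [|r]; first by case: leqP; lia.
have : (l * m <= m * (r.+1 * l))%N by rewrite mulSn mulnDr (mulnC l m) leq_addr.
rewrite (mulnC l m).
have h3 : (0 < l * j)%N by rewrite muln_gt0; lia.
by case: leqP => /=; lia.
Qed.

(** The lower bounds all become l m < m i + l j: this is i > l (1 - j/m), which is i > l/m at j = m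
    - 1 and i > l at j = 0. It is automatic for i = s l, and it is [theta_level] for i = r l - 1. *)
Lemma remainingP p : reflect (remaining l m c p) (slot l m c p).
Proof.
have m0 : (0 < m)%N by lia.
have l0 : (0 < l)%N by lia.
have sr1 r : (0 < r)%N -> (r * l - 1).+1 = (r * l)%N.
  by move=> r0; rewrite subn1 prednK // muln_gt0 r0.
have sr2 r : (0 < r)%N -> (r * l - 2).+1 = (r * l - 1)%N.
  by move=> r0; have : (0 + l <= r * l)%N by [rewrite leq_pmull]; lia.
have ndvd r : (0 < r)%N -> (l %| r * l - 1)%N = false.
  move=> r0; apply/negP => /dvd_succ; rewrite sr1 // dvdn_mull //.
have sj j : (1 <= j <= m - 2)%N -> (j - 1).+1 = j by lia.
have mj j : (1 <= j <= m - 2)%N -> (j.+1 == m) = false by lia.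
have jm j : (1 <= j <= m - 2)%N -> (0 < j < m)%N by lia.
have j0 j : (1 <= j <= m - 2)%N -> (j == 0)%N = false by lia.
have jm' j : (1 <= j <= m - 2)%N -> (j < m)%N by lia.
have lvs s j : (0 < s)%N -> (0 < j)%N -> (l * m < m * (s * l) + l * j)%N.
  move=> s0 jj; have : (0 < l * j)%N by rewrite muln_gt0 l0.
  have : (m * l <= m * (s * l))%N by rewrite leq_mul2l leq_pmull ?orbT.
  by rewrite (mulnC l m); lia.
have i0 i : ~~ (l %| i)%N -> (i - 1).+1 = i.
  by case: i => [|i]; rewrite ?dvdn0 // subn1.
apply: (iffP idP); last first.
  case; rewrite /slot /slot1 /slot2 /=.
  - move=> i j hj di di1; rewrite sj // levelE ?(ltnW (jm' _ hj)) // => ->.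
    by rewrite jm' // mj // (negPf di) -(addn1 i) (negPf di1).
  - move=> r j hj hr hz; have r0 : (0 < r)%N by lia.
    rewrite sj // jm' // -theta_level // ?hr ?jm //= mj // ndvd // sr1 //.
    by rewrite dvdn_mull // mulnK.
  - move=> s j hj hs hz; rewrite sj // jm' // lvs //; last by lia.
    by rewrite mj // dvdn_mull // mulnK.
  - move=> i di lv hz; have -> : (m - 2).+1 = m.-1 by lia.
    rewrite prednK // eqxx di hz -levelE //; last by lia.
    by rewrite (_ : m - m.-1 = 1)%N ?muln1 ?lv; lia.
  - move=> i j hj di di1; rewrite i0 // levelE ?(ltnW (jm' _ hj)) // => ->.
    by rewrite jm' // j0 // mj // (negPf di) -(addn1 i) (negPf di1).
  - move=> r j hj hr hz; have r0 : (0 < r)%N by lia.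
    rewrite sr2 // jm' // -theta_level // ?hr ?jm //= j0 // mj // ndvd // sr1 //.
    by rewrite dvdn_mull // mulnK.
  - move=> s j hj hs hz; rewrite sr1 // jm' // lvs //; last by lia.
    by rewrite j0 // mj // dvdn_mull // mulnK.
  - move=> i di di1 lv; rewrite i0 // m0 di -(addn1 i) di1 muln0 addn0.
    by rewrite mulnC ltn_pmul2l // lv.
  - move=> i di lv hz; rewrite (i0 i) //.
    have -> : (m - 1 == 0)%N = false by lia.
    have -> : ((m - 1).+1 == m) by lia.
    have -> : (m - 1 < m)%N by lia.
    rewrite di hz -levelE; last by lia.
    by rewrite (_ : m - (m - 1) = 1)%N ?muln1 ?lv; lia.
case: p => k [i j]; rewrite /slot /=; case: (I2_cases k) => -> /=.
  rewrite /slot1 => /and3P[hj lv]; case: eqP => [jm1 /andP[di hz]|jm1].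
    have -> : j = (m - 2)%N by lia.
    apply: Rem1_last => //; move: lv; rewrite -levelE; last by lia.
    by rewrite (_ : m - j.+1 = 1)%N ?muln1; lia.
  have hj' : (1 <= j.+1 <= m - 2)%N by lia.
  have e1 : (j.+1 - 1 = j)%N by rewrite subn1.
  case: ifP => [/dvdnP[s si]|di].
    have s0 : (0 < s)%N.
      case: s si => // i00; move: lv; rewrite -levelE; last by lia.
      by rewrite i00 muln0.
    rewrite {1}si mulnK // => hz.
    by have := @Rem1_s l m c s j.+1 hj' s0 hz; rewrite e1 -si.
  case: ifP => [/dvdnP[r ri]|di1].
    have r0 : (0 < r)%N by case: r ri.
    have e2 : (r * l - 1 = i)%N by rewrite -ri subn1.
    rewrite ri mulnK // => hz.
    have := @Rem1_r l m c r j.+1 hj'; rewrite theta_level // e2 e1.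
    by apply.
  move=> _; have := @Rem1_i l m c i j.+1 hj'.
  by rewrite di addn1 di1 levelE ?e1; [apply | lia].
have e1 : (i.+1 - 1 = i)%N by rewrite subn1.
rewrite /slot2 => /and3P[hj lv]; case: eqP => [j00 /andP[di di1]|/eqP j00].
  have := @Rem2_first l m c i.+1; rewrite e1 addn1 j00; apply=> //.
  by move: lv; rewrite j00 muln0 addn0 mulnC ltn_pmul2l.
case: eqP => [jm1 /andP[di hz]|jm1].
  have := @Rem2_last l m c i.+1 di; rewrite e1 (_ : m - 1 = j)%N; last by lia.
  apply=> //; move: lv; rewrite -levelE; last by lia.
  by rewrite (_ : m - j = 1)%N ?muln1; lia.
have hj' : (1 <= j <= m - 2)%N by lia.
case: ifP => [/dvdnP[s si]|di].
  have s0 : (0 < s)%N by case: s si.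
  rewrite si mulnK // => hz.
  by have := @Rem2_s l m c s j hj' s0 hz; rewrite -si e1.
case: ifP => [/dvdnP[r ri]|di1].
  have r0 : (0 < r)%N by case: r ri.
  have e2 : (r * l - 1 = i.+1)%N by rewrite -ri subn1.
  have e3 : (r * l - 2 = i)%N by lia.
  rewrite ri mulnK // => hz.
  have := @Rem2_r l m c r j hj'; rewrite theta_level ?jm // e2 e3.
  by apply.
move=> _; have := @Rem2_i l m c i.+1 j hj'.
by rewrite di addn1 di1 levelE ?e1; [apply | lia].
Qed.
End Slots.

(** * Bottom pairs of chains and remaining coefficients *)

Section ChainSlots.
Context (K : numFieldType) (l m : nat) (c : choices) (x y T : nat).
Context (m_gt1 : (1 < m)%N) (le_ml : (m <= l)%N) (l_gt2 : (2 < l)%N).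
Context (xl : (x < l)%N) (ym : (y < m)%N).
Context (lev : (l * m < m * (x + T * l) + l * y)%N).
Implicit Types u v : nat -> K.
Let i := (x + T * l)%N.

Let l_gt1 : (1 < l)%N. Proof. exact: ltnW. Qed.

Let lm_gt : (l + m < l * m)%N.
Proof.
have : (l * 2 <= l * m)%N by rewrite leq_mul2l m_gt1 orbT.
case: (leqP m 2) => [m2|m2]; first by rewrite (_ : m = 2%N); lia.
have : (l * 3 <= l * m)%N by rewrite leq_mul2l m2 orbT.
by lia.
Qed.

Let nz (n : nat) : (0 < n)%N -> n%:R != 0 :> K.
Proof. by rewrite pnatr_eq0 lt0n. Qed.

Let m1_nz : m%:R - 1 != 0 :> K.
Proof. by rewrite subr_eq0 pnatr_eq1 gtn_eqF. Qed.

Let dvd_i : (l %| i)%N = (x == 0)%N.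
Proof.
rewrite /i dvdn_addl ?dvdn_mull //; case: (posnP x) => [->|x0]; first by rewrite dvdn0.
by rewrite gtnNdvd // eqn0Ngt x0.
Qed.

Let dvd_i1 : (l %| i.+1)%N = (x.+1 == l)%N.
Proof.
rewrite /i -addSn dvdn_addl ?dvdn_mull //.
case: (eqVneq x.+1 l) => [->|ne]; first by rewrite dvdnn.
by rewrite gtnNdvd // ltn_neqAle ne.
Qed.

Let i_gt0 : (0 < i)%N.
Proof.
rewrite lt0n; apply/eqP => i0; move: lev; rewrite -/i i0 muln0 add0n.
by rewrite ltn_pmul2l; lia.
Qed.

Let T_gt0 : x = 0%N -> (0 < T)%N.
Proof. by move=> x0; move: i_gt0; rewrite /i x0 add0n muln_gt0 => /andP[]. Qed.

Let top_nz u v : chain l m x y T u v -> x = 0%N -> (0 < y)%N -> (y.+1 < m)%N ->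
  u 0%N != 0 -> u T != 0 /\ v T != 0.
Proof.
move=> ch x0 y0 ym1 u0; have := chain_scale (u 0%N)^-1 ch.
case: T T_gt0 ch => [/(_ x0)//|T'] _; rewrite x0 => _ ch.
have n1 : (u 0%N)^-1 * u 0%N = 1 by rewrite mulVf.
have := chain_top1_u l_gt1 m_gt1 lm_gt ch n1 y0 ym1 le_ml.
have := chain_top1_v l_gt1 m_gt1 lm_gt ch n1 y0 ym1 le_ml.
by rewrite !mulf_eq0 !negb_or => /andP[_ ->] /andP[_ ->].
Qed.

Let y0_top u v : chain l m x y T u v -> x = 0%N -> y = 0%N -> u 0%N = 0.
Proof.
move=> ch x0 y0; apply/eqP/contraT => u0.
have := chain_scale (u 0%N)^-1 ch.
case: T T_gt0 ch => [/(_ x0)//|T'] _; rewrite x0 => _ ch.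
have n1 : (u 0%N)^-1 * u 0%N = 1 by rewrite mulVf.
by case: (chain_top1_y0 l_gt1 m_gt1 lm_gt ch n1 y0).
Qed.

(** A bottom value that does not remain is either zero or tied to a remaining one by a line of
    finite nonzero slope. *)
Lemma chain_slot_inj u v : chain l m x y T u v ->
  (slot1 l m c i y -> u T = 0) -> (slot2 l m c i y -> v T = 0) ->
  u T = 0 /\ v T = 0.
Proof.
move=> ch; rewrite /slot1 /slot2 ym lev dvd_i dvd_i1 andbT /=.
have top0 : x = 0%N -> u 0%N = 0 -> u T = 0 /\ v T = 0.
  by move=> x0 u0; apply: (chain_top_eq0 l_gt1 m_gt1 x0 ch u0).
have hA : x.+1 = l -> y%:R * u T = i%:R * v T.
  move=> xl1; have [/(_ T (leqnn T)) + _] :=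
    defect_eq0 l_gt1 m_gt1 ch (or_introl (defect_top ch xl1)).
  by rewrite /defect subnn mul0n addn0 => /eqP; rewrite subr_eq0 => /eqP.
case: (posnP y) => [y0 _|y_gt0] /=.
  have uT := chain_uT ch y0 => h; split=> //.
  case: (posnP x) => [x0|x0]; first by have [] := top0 x0 (y0_top ch x0 y0).
  case: (eqVneq x.+1 l) => [xl1|xl1]; last by apply: h; rewrite -lt0n x0.
  have := hA xl1; rewrite uT mulr0 => /esym /eqP.
  by rewrite mulf_eq0 (negPf (nz _)) //= => /eqP.
case: eqVneq => [ym1|ym1].
  case: (posnP x) => [x0 _ _|x0] /=.
    (* For y = m - 1 the bottom defect vanishes, hence also the top one, which is (y + T m) u 0
       because v 0 = 0. *)
    apply: top0 => //; have [/(_ 0%N (leq0n T)) + _] :=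
      defect_eq0 l_gt1 m_gt1 ch (or_intror (defect_bot ch ym1)).
    rewrite /defect (chain_v0 ch x0) mulr0 subr0 => /eqP.
    by rewrite mulf_eq0 (negPf (nz _)) ?addn_gt0 ?y_gt0 //= => /eqP.
  have := chain_bot ch ym1; rewrite -/i => e h1 h2.
  case/orP: (neq_c1_c2 (zero_i c i)) => [/h1 uT|/h2 vT]; split=> //.
    by move/eqP: e; rewrite uT mulr0 mulf_eq0 (negPf (nz _)) //= => /eqP.
  by move/eqP: e; rewrite vT mulr0 eq_sym mulf_eq0 (negPf m1_nz) //= => /eqP.
have ym1' : (y.+1 < m)%N by rewrite ltn_neqAle ym1.
case: eqVneq => [x0|x0] /=.
  (* If u 0 were nonzero, both bottom values would be nonzero, but the one kept by [zero_s] is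
     zero. *)
  move=> h1 h2; apply: top0 => //; apply/eqP/contraT => u0.
  have [uT vT] := top_nz ch x0 y_gt0 ym1' u0.
  by case/orP: (neq_c1_c2 (zero_s c y (i %/ l)))
    => [/h1|/h2] e; move: uT vT; rewrite e eqxx.
case: eqVneq => [xl1|_] h1 h2; last by split; [apply: h1 | apply: h2].
have e := hA xl1.
case/orP: (neq_c1_c2 (zero_r c y (i.+1 %/ l))) => [/h1 uT|/h2 vT]; split=> //.
  by move/eqP: e; rewrite uT mulr0 eq_sym mulf_eq0 (negPf (nz _)) //= => /eqP.
by move/eqP: e; rewrite vT mulr0 mulf_eq0 (negPf (nz _)) //= => /eqP.
Qed.

Let chain0 : chain l m x y T (fun _ => 0 : K) (fun _ => 0).
Proof. by split=> * //; rewrite !mulr0 ?addr0 ?subr0. Qed.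

(** [k] is the component taken to be zero; a chain with both bottom values nonzero is rescaled to
    fit the other component. *)
Let line u v (k : 'I_2) (a1 a2 : K) : chain l m x y T u v ->
  u T != 0 -> v T != 0 ->
  exists u' v', [/\ chain l m x y T u' v', k != c1 -> u' T = a1 &
    k != c2 -> v' T = a2].
Proof.
move=> ch uT vT; case: (I2_cases k) => ->.
  exists (fun a => a2 / v T * u a), (fun a => a2 / v T * v a).
  by split=> //; [exact: chain_scale | rewrite divfK].
exists (fun a => a1 / u T * u a), (fun a => a1 / u T * v a).
by split=> //; [exact: chain_scale | rewrite divfK].
Qed.

(** Together with [chain_slot_inj], this makes the remaining bottom values free coordinates on the
    solutions of the chain equations. *)
Lemma chain_slot_surj (a1 a2 : K) : exists u v, [/\ chain l m x y T u v,
  slot1 l m c i y -> u T = a1 & slot2 l m c i y -> v T = a2].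
Proof.
rewrite /slot1 /slot2 ym lev dvd_i dvd_i1 andbT /=.
case: (posnP y) => [y0|y_gt0] /=.
  case: andP => [[x0 xl1]|_]; last by exists (fun _ => 0), (fun _ => 0).
  have ml : 1%N != m by rewrite neq_ltn m_gt1.
  have [] := @chain_exists_bot K l m x y T l_gt1 m_gt1 0 a2.
  - by rewrite lt0n.
  - by [].
  - by move=> e; rewrite -e y0 in ml.
  - by move=> e; rewrite e eqxx in xl1.
  - by move=> u [v [ch _ vT]]; exists u, v; split.
case: eqVneq => [ym1|ym1].
  case: (posnP x) => [x0|x0] /=; first by exists (fun _ => 0), (fun _ => 0).
  have e : y%:R = m%:R - 1 :> K by rewrite -ym1 -natr1 addrK.
  (* The pair (i, y) satisfies i v = (m - 1) u because y = m - 1, and also y u = i v, as required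
     when x = l - 1; both entries are nonzero. *)
  have [] := @chain_exists_bot K l m x y T l_gt1 m_gt1 i%:R y%:R.
  - by [].
  - by move=> e'; rewrite e' in y_gt0.
  - by rewrite -e mulrC.
  - by rewrite mulrC.
  - move=> u [v [ch uT vT]]; apply: (line _ _ _ ch); rewrite ?uT ?vT nz //.
have ym1' : (y.+1 < m)%N by rewrite ltn_neqAle ym1.
case: eqVneq => [x0|x0] /=.
  have [u [v [ch u0]]] := @chain_exists_top K l m x y T l_gt1 x0 y_gt0 ym1'.
  have [|uT vT] := top_nz ch x0 y_gt0 ym1'; first by rewrite u0 oner_eq0.
  exact: line ch uT vT.
have bot b1 b2 : (x.+1 = l -> y%:R * b1 = i%:R * b2) ->
    exists u v, [/\ chain l m x y T u v, u T = b1 & v T = b2].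
  move=> h; apply: chain_exists_bot => //; first by rewrite lt0n.
  - by move=> e; rewrite e in y_gt0.
  - by move=> e; rewrite e eqxx in ym1.
case: eqVneq => [xl1|xl1].
  have [|u [v [ch uT vT]]] := bot i%:R y%:R; first by rewrite mulrC.
  by apply: (line _ _ _ ch); rewrite ?uT ?vT nz.
have [|u [v [ch uT vT]]] := bot a1 a2; last by exists u, v.
by move/eqP: xl1.
Qed.

End ChainSlots.

(** * Resonant minors *)

Section DualBasis.
Context (K : fieldType) (r n : nat) (M : 'M[K]_(r, n)) (S : pred 'I_n).
Context (S_inj : forall w : 'rV[K]_n, w *m M^T = 0 ->
  (forall q, S q -> w 0 q = 0) -> w = 0).

(** By [S_inj], no nonzero vector is orthogonal to the rows of [M] and to the unit vectors indexed
    by [S], so together these span the whole space. *)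
Lemma rowspace_decomposition (v : 'rV[K]_n) : exists (d : 'rV[K]_r) (w : 'rV[K]_n),
  v = d *m M + w /\ forall q, ~~ S q -> w 0 q = 0.
Proof.
pose P : 'M[K]_n := diag_mx (\row_q (S q)%:R).
have full : row_full (col_mx M P).
  rewrite /row_full -mxrank_tr; apply: inj_row_free => w.
  rewrite tr_col_mx mul_mx_row => /eqP; rewrite -[0]row_mx0 => /eqP /eq_row_mx [wM wP].
  apply: S_inj => // q Sq; have /rowP/(_ q) := wP.
  by rewrite tr_diag_mx mul_mx_diag !mxE Sq mulr1.
have /submxP[D ->] : (v <= col_mx M P)%MS by apply: submx_full.
exists (lsubmx D), (rsubmx D *m P); split.
  by rewrite -mul_row_col hsubmxK.
by move=> q /negPf Sq; rewrite mul_mx_diag !mxE Sq mulr0.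
Qed.

Context (S_surj : forall q, S q -> exists w : 'rV[K]_n, w *m M^T = 0 /\
  forall q', S q' -> w 0 q' = (q' == q)%:R).

Let f : 'I_#|S| -> 'I_n := @enum_val _ S.

Let fS j : S (f j). Proof. exact: enum_valP. Qed.

Let rank_ker : \rank (kermx M^T) = (n - \rank M)%N.
Proof. by rewrite mxrank_ker mxrank_tr. Qed.

Let colsub_free k (A : 'M[K]_(k, n)) : row_free A -> (A <= kermx M^T)%MS ->
  row_free (colsub f A).
Proof.
move=> Afree AM; apply: inj_row_free => x xA.
apply/eqP; rewrite -(mulmx_free_eq0 _ Afree); apply/eqP/S_inj.
  by apply/sub_kermxP/(submx_trans (submxMl _ _)).
move=> q Sq; have /rowP/(_ (enum_rank_in Sq q)) := xA.
by rewrite !mxE; under eq_bigr do rewrite mxE /f enum_rankK_in //.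
Qed.

(** The dual vectors of [S_surj] are #|S| independent elements of the kernel; conversely a basis of
    the kernel stays free when restricted to the #|S| columns in [S]. *)
Lemma card_slots : #|S| = (n - \rank M)%N.
Proof.
apply/eqP; rewrite eqn_leq -rank_ker; apply/andP; split.
  have [W hW] := fin_all_exists (fun j => S_surj (fS j)).
  pose B : 'M[K]_(#|S|, n) := \matrix_j W j.
  have /eqP <- : row_free B.
    apply: inj_row_free => v vB; apply/rowP => j; have /rowP/(_ (f j)) := vB.
    rewrite !mxE (bigD1 j) //= big1 ?addr0 => [|k kj]; rewrite mxE.
      by case: (hW j) => _ ->; rewrite ?eqxx ?mulr1.
    case: (hW k) => _ -> //; rewrite (inj_eq enum_val_inj) eq_sym (negPf kj).
    by rewrite mulr0.
  apply/mxrankS/row_subP => j; rewrite rowK.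
  by apply/sub_kermxP; case: (hW j).
have := row_base_free (kermx M^T) => /colsub_free.
rewrite eq_row_base submx_refl => /(_ isT) /eqP <-; exact: rank_leq_col.
Qed.

Lemma resonant_minor : exists t : 'I_(n - \rank M) -> 'I_n,
  (forall q, S q <-> exists j, t j = q) /\
  forall A : 'M[K]_(n - \rank M, n), row_free A -> (A <= kermx M^T)%MS ->
    \det (\matrix_(i < n - \rank M, j < n - \rank M) A i (t j)) != 0.
Proof.
(* With size #|S| the restriction of [A] to the columns in [S] is square, so that freeness becomes
   invertibility. *)
rewrite -card_slots; exists f; split=> [q|A Afree AM].
  split=> [Sq|[j <-] //]; exists (enum_rank_in Sq q); exact: enum_rankK_in.
have -> : \matrix_(i, j) A i (f j) = colsub f A by apply/matrixP => i j; rewrite !mxE.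
by have := colsub_free Afree AM; rewrite row_free_unit unitmxE unitfE.
Qed.
End DualBasis.

(** * Brackets of monomial fields *)

Section Monomials.
Context (K : fieldType).
Implicit Types (f h : series K) (P Q : vseries K).

Lemma smul_monomial (c : K) p q f a b : smul (smonomial c p q) f a b =
  if (p <= a)%N && (q <= b)%N then c * f (a - p)%N (b - q)%N else 0.
Proof.
rewrite /smul /smonomial; case: ifP => [/andP[pa qb]|pq].
  have pa' : (p < a.+1)%N by [].
  have qb' : (q < b.+1)%N by [].
  rewrite (bigD1 (Ordinal pa')) //= (bigD1 (Ordinal qb')) //= !eqxx.
  rewrite !big1 ?addr0 // => [i ne|j ne].
    by apply: big1 => j _; rewrite -val_eqE /= in ne; rewrite (negPf ne) mul0r.
  by rewrite -val_eqE /= in ne; rewrite (negPf ne) mul0r.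
apply: big1 => i _; apply: big1 => j _.
case: eqP => [ip|_]; last by rewrite mul0r.
case: eqP => [jq|_]; last by rewrite mul0r.
by move: pq; rewrite -ip -jq (leq_ord i) (leq_ord j).
Qed.

Lemma smul0r f : smul f (fun _ _ => 0) = fun _ _ => 0.
Proof.
apply/funext => a; apply/funext => b.
by apply: big1 => i _; apply: big1 => j _; rewrite mulr0.
Qed.

Lemma smul0l f : smul (fun _ _ => 0) f = fun _ _ => 0.
Proof.
apply/funext => a; apply/funext => b.
by apply: big1 => i _; apply: big1 => j _; rewrite mul0r.
Qed.

Lemma smul_monomials (c c' : K) p q p' q' :
  smul (smonomial c p q) (smonomial c' p' q') = smonomial (c * c') (p + p') (q + q').
Proof.
apply/funext => a; apply/funext => b; rewrite smul_monomial /smonomial.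
case: ifP => [/andP[pa qb]|pq].
  have -> : (a - p == p')%N = (a == p + p')%N by lia.
  have -> : (b - q == q')%N = (b == q + q')%N by lia.
  by case: ifP; rewrite ?mulr0.
case: ifP => // /andP[/eqP ea /eqP eb]; move: pq.
by rewrite ea eb !leq_addr.
Qed.

Lemma smonomial0 p q : smonomial (0 : K) p q = fun _ _ => 0.
Proof. by apply/funext => a; apply/funext => b; rewrite /smonomial if_same. Qed.

Lemma spartial_monomial i (c : K) p q : spartial i (smonomial c p q) =
  if i == c1 then smonomial (c *+ p) p.-1 q else smonomial (c *+ q) p q.-1.
Proof.
apply/funext => a; apply/funext => b; rewrite /spartial.
case: ifP => _; rewrite /smonomial.
  case: p => [|p]; first by rewrite mul0rn mulr0n if_same.
  rewrite eqSS /=; case: eqP => [->|] /=; last by rewrite mul0rn.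
  by case: ifP; rewrite ?mul0rn.
case: q => [|q]; first by rewrite andbF mul0rn mulr0n if_same.
rewrite eqSS /=; case: eqP => _ /=; last by rewrite mul0rn.
by case: eqP => [->|]; rewrite ?mul0rn.
Qed.

Lemma spartial0 i : spartial i (fun _ _ => 0 : K) = fun _ _ => 0.
Proof.
by apply/funext => a; apply/funext => b; rewrite /spartial !mul0rn if_same.
Qed.

Lemma vapplyE P f : vapply P f =
  sadd (smul (P c1) (spartial c1 f)) (smul (P c2) (spartial c2 f)).
Proof.
apply/funext => a; apply/funext => b.
rewrite /vapply /sadd big_ord_recl big_ord1.
by have -> : lift ord0 ord0 = c2 :> 'I_2 by exact: val_inj.
Qed.

Lemma smonomialE (c : K) p q (a : nat * nat) :
  smonomial c p q a.1 a.2 = c * (a == (p, q))%:R.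
Proof.
case: a => a b; rewrite /smonomial /= xpair_eqE.
by case: ifP; rewrite ?mulr1 ?mulr0.
Qed.

(** The truncation in [p.-1] and [q.-1] is harmless: the factor [p%:R] or [q%:R] vanishes in that
    case. *)
Lemma bracket_monomial1 l m minus p q (x : position) : (1 < l)%N -> (1 < m)%N ->
  coefficient (bracket (unperturbed K l m minus)
    (monomial_field K (c1, (p, q)))) x =
  (x == (c1, (p.-1, q + (m - 1))))%N%:R * ((-1) ^+ minus * p%:R)
  + (x == (c1, (p + (l - 1), q.-1)))%N%:R * q%:R
  - (x == (c2, (p + (l - 2), q)))%N%:R * (l%:R - 1).
Proof.
move=> l_gt1 m_gt1; case: x => k a.
rewrite /coefficient /bracket /= !vapplyE.
rewrite /monomial_field /= /unperturbed.
case: (I2_cases k) => -> /=; rewrite !xpair_eqE /= ?smul0l ?spartial0 ?smul0r.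
  rewrite /vec2 /= !spartial_monomial /= mulr0n smonomial0 smul0r !smul_monomials.
  rewrite /sadd !smonomialE /= !mul0r mul1r.
  by rewrite add0n (addnC (m - 1)%N) (addnC (l - 1)%N); ring.
rewrite /vec2 /= !spartial_monomial /= smul_monomials.
rewrite /sadd smonomialE /= mul1r -subn1 -subnDA addn0.
by rewrite natrB 1?ltnW //; ring.
Qed.

Lemma bracket_monomial2 l m minus p q (x : position) : (1 < l)%N -> (1 < m)%N ->
  coefficient (bracket (unperturbed K l m minus)
    (monomial_field K (c2, (p, q)))) x =
  (x == (c2, (p.-1, q + (m - 1))))%N%:R * ((-1) ^+ minus * p%:R)
  + (x == (c2, (p + (l - 1), q.-1)))%N%:R * q%:R
  - (x == (c1, (p, q + (m - 2))))%N%:R * ((-1) ^+ minus * (m%:R - 1)).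
Proof.
move=> l_gt1 m_gt1; case: x => k a.
rewrite /coefficient /bracket /= !vapplyE.
rewrite /monomial_field /= /unperturbed.
case: (I2_cases k) => -> /=; rewrite !xpair_eqE /= ?smul0l ?spartial0 ?smul0r.
  rewrite /vec2 /= !spartial_monomial /= smul_monomials.
  rewrite /sadd smonomialE /= -subn1 -subnDA addn0 mul1r.
  rewrite -[_ *+ (m - 1)]mulr_natr natrB 1?ltnW //; ring.
rewrite /vec2 /= !spartial_monomial /= mulr0n smonomial0 smul0r !smul_monomials.
rewrite /sadd !smonomialE /= !mul1r.
by rewrite !add0n (addnC (m - 1)%N) (addnC (l - 1)%N); ring.
Qed.

End Monomials.

(** * Monomial bases and weights *)

Lemma monomialsE (g : 'I_2 -> nat) n a : (0 < g c1)%N -> (0 < g c2)%N ->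
  (a \in monomials g n) = (gdegree g a == n).
Proof.
move=> g1 g2; rewrite mem_filter; case: eqP => // <-; rewrite andTb.
case: a => a b; rewrite /gdegree /fst /snd; apply/idP.
apply/allpairsP; exists (a, b); split=> //; rewrite mem_iota add0n ltnS /=.
  by rewrite (leq_trans _ (leq_addr _ _)) // leq_pmulr.
by rewrite (leq_trans _ (leq_addl _ _)) // leq_pmulr.
Qed.

Lemma qhbasisE (g : 'I_2 -> nat) k p : (0 < g c1)%N -> (0 < g c2)%N ->
  (p \in qhbasis g k) = (gdegree g p.2 == k + g p.1)%N.
Proof.
move=> g1 g2; rewrite -(monomialsE _ _ g1 g2); case: p => i a /=.
apply/allpairsPdep/idP => [[i' [a' [_ + [-> ->]]]] //|ai].
by exists i, a; split=> //; rewrite mem_enum.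
Qed.

Lemma qhbasis_uniq (g : 'I_2 -> nat) k : uniq (qhbasis g k).
Proof.
apply: allpairs_uniq_dep; rewrite ?enum_uniq //.
  move=> i _; apply/filter_uniq/allpairs_uniq; rewrite ?iota_uniq //.
  by move=> [? ?] [? ?] _ _ [-> ->].
by move=> [i a] [j b] _ _ /= [-> ->].
Qed.

Lemma qhbasis_nth_inj (g : 'I_2 -> nat) k : injective (@qhbasis_nth g k).
Proof. by apply/tuple_uniqP/qhbasis_uniq. Qed.

Lemma mem_qhbasis_nth (g : 'I_2 -> nat) k i : @qhbasis_nth g k i \in qhbasis g k.
Proof. exact: mem_tnth. Qed.

Lemma qhbasis_nthP (g : 'I_2 -> nat) k p : p \in qhbasis g k ->
  exists i, @qhbasis_nth g k i = p.
Proof. by move=> /(@tnthP _ _ (in_tuple (qhbasis g k)) p) [i ->]; exists i. Qed.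

Section Weights.
Context (l m : nat) (m_gt1 : (1 < m)%N) (le_ml : (m <= l)%N) (l_gt2 : (2 < l)%N).
Let g := weight l m.

(** With d = gcd(l, m), the last equation is lm/d = chi + m/d + l/d; it says that x_1^l, and so
    x_2^m, has generalized degree chi + g_1 + g_2. *)
Lemma weight_facts : exists d, [/\ (0 < d)%N, l = (d * g c2)%N, m = (d * g c1)%N &
  (l * g c1)%N = (chi l m + g c1 + g c2)%N].
Proof.
have d_gt0 : (0 < gcdn l m)%N by rewrite gcdn_gt0; lia.
exists (gcdn l m); rewrite /g /weight /vec2 /=.
set d := gcdn l m in d_gt0 *.
have el : l = (d * (l %/ d))%N by rewrite mulnC divnK ?dvdn_gcdl.
have em : m = (d * (m %/ d))%N by rewrite mulnC divnK ?dvdn_gcdr.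
split=> //; rewrite /chi -/d.
move: (l %/ d)%N (m %/ d)%N el em => l' m' el em.
have -> : (l * m - l - m = d * (l * m' - l' - m'))%N.
  by rewrite !mulnBr mulnCA -em -el.
rewrite mulKn //.
have m'0 : (0 < m')%N by case: m' em => //; lia.
(* The subtraction in [chi] does not truncate: for d = 1 by 2 <= m <= l, for d >= 2 by l m' >= 2 l'
   m'. *)
have : (l' + m' <= l * m')%N.
  case: d d_gt0 el em => [//|[|d]] _ el em.
    rewrite !mul1n in el em; rewrite -el -em.
    have : (l * 2 <= l * m)%N by rewrite leq_mul2l m_gt1 orbT.
    by lia.
  have : (l' * 1 <= l' * m')%N by rewrite leq_mul2l m'0 orbT.
  have : (m' <= l')%N by move: le_ml; rewrite el em leq_pmul2l.
  have : (2 * (l' * m') <= l * m')%N by rewrite el -mulnA leq_mul2r orbT.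
  by rewrite muln1; lia.
by lia.
Qed.

Lemma weight1_gt0 : (0 < g c1)%N.
Proof.
by have [d [d0 _ em _]] := weight_facts; case: (g c1) em => //; rewrite muln0; lia.
Qed.

Lemma weight2_gt0 : (0 < g c2)%N.
Proof.
by have [d [d0 em _ _]] := weight_facts; case: (g c2) em => //; rewrite muln0; lia.
Qed.

Lemma weight_lm : (l * g c1 = m * g c2)%N.
Proof.
have [d [_ el em _]] := weight_facts; move: (g c1) (g c2) el em => a b -> ->.
by rewrite mulnAC.
Qed.

Lemma weight_l : (l * g c1 = chi l m + g c1 + g c2)%N.
Proof. by have [d []] := weight_facts. Qed.

Lemma weight_m : (m * g c2 = chi l m + g c1 + g c2)%N.
Proof. by rewrite -weight_lm weight_l. Qed.

(** After division by d, the inequality defining the slots says that the fields x_1^i x_2^(j-1) in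
    the first component and x_1^(i-1) x_2^j in the second have generalized degree above chi. *)
Lemma level_gt i j :
  (l * m < m * i + l * j)%N = (chi l m + g c1 + g c2 < i * g c1 + j * g c2)%N.
Proof.
have [d [d0 el em e]] := weight_facts; rewrite -e.
have -> : (l * m = d * (l * g c1))%N by rewrite mulnCA -em.
have -> : (m * i + l * j = d * (i * g c1 + j * g c2))%N.
  by rewrite mulnDr (mulnC i) (mulnC j) !mulnA -em -el.
by rewrite ltn_pmul2l.
Qed.

End Weights.

(** * Functionals vanishing on the image of the homological operator *)

Section Functional.
Context (K : numFieldType) (l m : nat) (minus : bool) (c : choices).
Context (m_gt1 : (1 < m)%N) (le_ml : (m <= l)%N) (l_gt2 : (2 < l)%N).

Let g := weight l m.
Let ch := chi l m.
Let H := unperturbed K l m minus.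
Let s : K := (-1) ^+ minus.
Let l_gt1 : (1 < l)%N. Proof. exact: ltnW. Qed.
Let g1 : (0 < g c1)%N. Proof. exact: weight1_gt0. Qed.
Let g2 : (0 < g c2)%N. Proof. exact: weight2_gt0. Qed.
Let lg : (l * g c1 = ch + g c1 + g c2)%N. Proof. exact: weight_l. Qed.
Let mg : (m * g c2 = ch + g c1 + g c2)%N. Proof. exact: weight_m. Qed.
Let ss : s * s = 1. Proof. by rewrite /s -signr_addb addbb. Qed.

(* [W] is the value at each monomial field of a functional vanishing on the
   image of [H, -]. *)
Definition annihilates (W : position -> K) : Prop :=
  (forall p q, s * p%:R * W (c1, (p.-1, q + (m - 1)))%N
    + q%:R * W (c1, (p + (l - 1), q.-1))%N
    = (l%:R - 1) * W (c2, (p + (l - 2), q))%N) /\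
  (forall p q, s * p%:R * W (c2, (p.-1, q + (m - 1)))%N
    + q%:R * W (c2, (p + (l - 1), q.-1))%N
    = s * (m%:R - 1) * W (c1, (p, q + (m - 2)))%N).

Let memE i a b k : ((i, (a, b)) \in qhbasis g k) =
  (a * g c1 + b * g c2 == k + g i)%N.
Proof. by rewrite qhbasisE. Qed.

(** The targets occurring in [H, e] have degree k + chi exactly when e has degree k; positivity
    excludes truncated predecessors. *)
Let mem_x1 i p q k : (0 < p)%N ->
  ((i, (p.-1, q + (m - 1)))%N \in qhbasis g (k + ch)) =
  ((i, (p, q)) \in qhbasis g k).
Proof.
case: p => // p _; rewrite !memE /= mulSn mulnDl mulnBl mul1n mg; apply/eqP/eqP; lia.
Qed.

Let mem_x2 i p q k : (0 < q)%N ->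
  ((i, (p + (l - 1), q.-1))%N \in qhbasis g (k + ch)) =
  ((i, (p, q)) \in qhbasis g k).
Proof.
case: q => // q _; rewrite !memE /= mulSn mulnDl mulnBl mul1n lg; apply/eqP/eqP; lia.
Qed.

Let mem_x3 p q k : ((c2, (p + (l - 2), q))%N \in qhbasis g (k + ch)) =
  ((c1, (p, q)) \in qhbasis g k).
Proof.
rewrite !memE mulnDl mulnBl lg.
have : (2 * g c1 <= l * g c1)%N by rewrite leq_mul2r l_gt1 orbT.
by rewrite lg => h; apply/eqP/eqP; lia.
Qed.

Let mem_x4 p q k : ((c1, (p, q + (m - 2)))%N \in qhbasis g (k + ch)) =
  ((c2, (p, q)) \in qhbasis g k).
Proof.
rewrite !memE mulnDl mulnBl mg.
have : (2 * g c2 <= m * g c2)%N by rewrite leq_mul2r m_gt1 orbT.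
by rewrite mg => h; apply/eqP/eqP; lia.
Qed.

Let sum_pick (r : seq position) (W : position -> K) x (a : K) : uniq r ->
  \sum_(p <- r) W p * ((p == x)%:R * a) = (x \in r)%:R * (W x * a).
Proof.
move=> r_uniq; case: (boolP (x \in r)) => [xr|xr].
  rewrite (bigD1_seq x) //= eqxx mul1r big1 ?addr0 ?mul1r // => p /negPf ->.
  by rewrite mul0r mulr0.
rewrite mul0r big1_seq // => p /andP[_ pr].
case: eqP => [e|]; last by rewrite mul0r mulr0.
by rewrite -e pr in xr.
Qed.

Let pairing (W : position -> K) k x : K := \sum_(p <- qhbasis g (k + ch))
  W p * coefficient (bracket H (monomial_field K x)) p.

Let pairing1 W k p q : pairing W k (c1, (p, q)) =
  ((c1, (p, q)) \in qhbasis g k)%:R *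
  (s * p%:R * W (c1, (p.-1, q + (m - 1)))%N
    + q%:R * W (c1, (p + (l - 1), q.-1))%N
    - (l%:R - 1) * W (c2, (p + (l - 2), q))%N).
Proof.
rewrite /pairing; under eq_bigr => x _ do rewrite /H bracket_monomial1 // mulrBr mulrDr.
rewrite sumrB big_split /= !sum_pick ?qhbasis_uniq // mem_x3 -/s.
case: p => [|p].
  case: q => [|q]; first by rewrite !(mulr0, mul0r, add0r); ring.
  by rewrite mem_x2 // !(mulr0, mul0r, add0r); ring.
rewrite mem_x1 //.
case: q => [|q]; first by rewrite !(mulr0, mul0r, addr0); ring.
by rewrite mem_x2 //; ring.
Qed.

Let pairing2 W k p q : pairing W k (c2, (p, q)) =
  ((c2, (p, q)) \in qhbasis g k)%:R *
  (s * p%:R * W (c2, (p.-1, q + (m - 1)))%N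
    + q%:R * W (c2, (p + (l - 1), q.-1))%N
    - s * (m%:R - 1) * W (c1, (p, q + (m - 2)))%N).
Proof.
rewrite /pairing; under eq_bigr => x _ do rewrite /H bracket_monomial2 // mulrBr mulrDr.
rewrite sumrB big_split /= !sum_pick ?qhbasis_uniq // mem_x4 -/s.
case: p => [|p].
  case: q => [|q]; first by rewrite !(mulr0, mul0r, add0r); ring.
  by rewrite mem_x2 // !(mulr0, mul0r, add0r); ring.
rewrite mem_x1 //.
case: q => [|q]; first by rewrite !(mulr0, mul0r, addr0); ring.
by rewrite mem_x2 //; ring.
Qed.

Let pairing_mx (W : position -> K) k (w : 'rV[K]_(qhdim g (k + ch))) :
  (forall q, w 0 q = W (qhbasis_nth q)) ->
  forall i, (w *m (homological_mx g ch H k)^T) 0 i = pairing W k (qhbasis_nth i).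
Proof.
move=> wW i; rewrite mxE /pairing [RHS]big_tnth.
by apply: eq_bigr => j _; rewrite !mxE wW.
Qed.

Lemma annihilates_mx W k : annihilates W ->
  (\row_q W (qhbasis_nth q)) *m (homological_mx g ch H k)^T = 0.
Proof.
move=> [h1 h2]; apply/rowP => i.
rewrite (@pairing_mx W) ?mxE => [|q]; last by rewrite mxE.
case: (qhbasis_nth i) => k' [p q].
case: (I2_cases k') => ->; first by rewrite pairing1 h1 subrr mulr0.
by rewrite pairing2 h2 subrr mulr0.
Qed.

Lemma mx_annihilates W k :
  (forall p, p \notin qhbasis g (k + ch) -> W p = 0) ->
  (\row_q W (qhbasis_nth q)) *m (homological_mx g ch H k)^T = 0 ->
  annihilates W.
Proof.
move=> W0 hM.
have pair0 x : x \in qhbasis g k -> pairing W k x = 0.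
  move=> /qhbasis_nthP[i <-].
  by rewrite -(@pairing_mx W k (\row_q W (qhbasis_nth q))) ?hM ?mxE // => q; rewrite mxE.
(* Outside degree k the relations hold term by term: either the numerical factor is 0 or [W] is
   evaluated outside degree k + chi. *)
have z1 i p q : (i, (p, q)) \notin qhbasis g k ->
    p%:R * W (i, (p.-1, q + (m - 1)))%N = 0.
  case: p => [|p] nx; first by rewrite mul0r.
  by rewrite W0 ?mulr0 // mem_x1.
have z2 i p q : (i, (p, q)) \notin qhbasis g k ->
    q%:R * W (i, (p + (l - 1), q.-1))%N = 0.
  case: q => [|q] nx; first by rewrite mul0r.
  by rewrite W0 ?mulr0 // mem_x2.
split=> p q.
  have := pair0 (c1, (p, q)); rewrite pairing1.
  case: (boolP (_ \in _)) => [_ /(_ isT)|nx _].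
    by rewrite mul1r => /eqP; rewrite subr_eq0 => /eqP.
  by rewrite -mulrA z1 // z2 // W0 ?mem_x3 // !mulr0 addr0.
have := pair0 (c2, (p, q)); rewrite pairing2.
case: (boolP (_ \in _)) => [_ /(_ isT)|nx _].
  by rewrite mul1r => /eqP; rewrite subr_eq0 => /eqP.
by rewrite -mulrA z1 // z2 // W0 ?mem_x4 // !mulr0 addr0.
Qed.

(** The values at j = 0, respectively i = 0, where there is no monomial, are set to 0; they yield
    [chain_uT] and [chain_v0]. *)
Let U (W : position -> K) (i j : nat) : K := if j is j'.+1 then W (c1, (i, j')) else 0.
Let V (W : position -> K) (i j : nat) : K := if i is i'.+1 then W (c2, (i', j)) else 0.

Let su2 a : (- s) ^+ a * (- s) ^+ a = 1.
Proof. by rewrite -exprMn mulrNN ss expr1n. Qed.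

Let suS a : (- s) ^+ a.+1 = - s * (- s) ^+ a. Proof. exact: exprS. Qed.

(** With [z] a power of [- s], multiplying by [- s * z] and using s * s = 1 removes the sign of H
    from the relation. *)
Let step1 (a z p w1 w2 w3 t : K) : s * p * w1 + a * w2 = t * w3 ->
  a * (- s * z * w2) = t * (- s * z * w3) + p * (z * w1).
Proof.
move=> e; have -> : a * (- s * z * w2) = - s * z * (a * w2) by ring.
have -> : a * w2 = t * w3 - s * p * w1 by rewrite -e; ring.
by rewrite -[p * _ in RHS]mul1r -ss; ring.
Qed.

Let step2 (a z p v1 v2 u1 t : K) : s * p * v1 + a * v2 = s * t * u1 ->
  a * (- s * z * v2) = p * (z * v1) - t * (z * u1).
Proof.
move=> e; have -> : a * (- s * z * v2) = - s * z * (a * v2) by ring.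
have -> : a * v2 = s * t * u1 - s * p * v1 by rewrite -e; ring.
by rewrite -[RHS]mul1r -ss; ring.
Qed.

Let step3 (z p v1 u1 t : K) : s * p * v1 = s * t * u1 ->
  p * (z * v1) = t * (z * u1).
Proof.
move=> e; rewrite -[LHS]mul1r -[RHS]mul1r -ss.
have -> : s * s * (p * (z * v1)) = s * z * (s * p * v1) by ring.
by rewrite e; ring.
Qed.

(** [chain_u] is the first relation of [annihilates] at p = x + a l + 1, q = y + (T - a - 1) m, and
    [chain_v] the second one at p = x + a l, q = y + (T - a - 1) m + 1. [chain_top] is the first one
    at p = 0 and [chain_bot] the second one at q = 0. *)
Lemma annihilates_chain W x y T : annihilates W ->
  chain l m x y T (fun a => (- s) ^+ a * U W (x + a * l) (y + (T - a) * m))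
                  (fun a => (- s) ^+ a * V W (x + a * l) (y + (T - a) * m)).
Proof.
move=> [h1 h2].
have l0 : (0 < l)%N by apply: ltnW.
have m0 : (0 < m)%N by apply: ltnW.
split.
- move=> a aT; have -> : (T - a = (T - a.+1).+1)%N by lia.
  set q := (y + (T - a.+1) * m)%N.
  have -> : (y + (T - a.+1).+1 * m = (q + (m - 1)).+1)%N by rewrite /q mulSn; lia.
  have -> : (x + a.+1 * l = (x + a * l + (l - 1)).+1)%N by rewrite mulSn; lia.
  have := h1 (x + a * l).+1 q; rewrite suS /=.
  have -> : ((x + a * l).+1 + (l - 1) = (x + a * l + (l - 1)).+1)%N by lia.
  have -> : ((x + a * l).+1 + (l - 2) = x + a * l + (l - 1))%N by lia.
  have e : q%:R * W (c1, ((x + a * l + (l - 1)).+1, q.-1)) =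
      q%:R * U W (x + a * l + (l - 1)).+1 q by case: (q); rewrite ?mul0r.
  by rewrite e addn1 => /step1; apply.
- move=> a aT; have -> : (T - a = (T - a.+1).+1)%N by lia.
  set q := (y + (T - a.+1) * m)%N.
  have -> : (y + (T - a.+1).+1 * m = (q + (m - 1)).+1)%N by rewrite /q mulSn; lia.
  have -> : (x + a.+1 * l = (x + a * l + (l - 1)).+1)%N by rewrite mulSn; lia.
  have := h2 (x + a * l)%N q.+1; rewrite suS /=.
  have -> : (q.+1 + (m - 1) = (q + (m - 1)).+1)%N by lia.
  have -> : (q.+1 + (m - 2) = q + (m - 1))%N by lia.
  have e : (x + a * l)%:R * W (c2, ((x + a * l).-1, (q + (m - 1)).+1)) =
      (x + a * l)%:R * V W (x + a * l) (q + (m - 1)).+1.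
    by case: (x + a * l)%N; rewrite ?mul0r.
  by rewrite -mulrA e mulrA addn1 => /step2.
- move=> xl1; rewrite mul0n addn0 subn0 expr0 !mul1r.
  have := h1 0%N (y + T * m)%N; rewrite mulr0 mul0r add0r !add0n.
  have -> : (l - 2 = x.-1)%N by lia.
  have -> : (l - 1 = x)%N by lia.
  have : (0 < x)%N by lia.
  case: (x) => // x' _ /= <-.
  by case: (y + T * m)%N; rewrite ?mul0r.
- move=> ym1; rewrite subnn mul0n addn0.
  have := h2 (x + T * l)%N 0%N; rewrite mul0r addr0 !add0n.
  have -> : (m - 2 = y.-1)%N by lia.
  have -> : (m - 1 = y)%N by lia.
  have : (0 < y)%N by lia.
  case: (y) => // y' _ /=.
  have -> : s * (x + T * l)%:R * W (c2, ((x + T * l).-1, y'.+1)) =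
      s * (x + T * l)%:R * V W (x + T * l) y'.+1.
    by case: (x + T * l)%N; rewrite ?mulr0 ?mul0r.
  exact: step3.
- by move=> ->; rewrite /= mulr0.
- by move=> ->; rewrite subnn /= mulr0.
Qed.

Lemma annihilates_inj W k : (0 < k)%N -> annihilates W ->
  (forall p, p \notin qhbasis g (k + ch) -> W p = 0) ->
  (forall p, slot l m c p -> W p = 0) -> forall p, W p = 0.
Proof.
move=> k_gt0 hW W0 WS p; case: (boolP (p \in qhbasis g (k + ch))) => [|/W0//].
have m0 : (0 < m)%N by apply: ltnW.
have l0 : (0 < l)%N by apply: ltnW.
have key i j : (l * m < m * i + l * j)%N -> U W i j = 0 /\ V W i j = 0.
  (* The point (i, j) has index i %/ l on the chain with bottom (x + T l, y). Since m i + l j is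
     constant along a chain, the bottom satisfies the same inequality. *)
  move=> lev; set x := (i %% l)%N; set y := (j %% m)%N.
  set T := (i %/ l + j %/ m)%N.
  have xl : (x < l)%N by rewrite ltn_mod.
  have ym : (y < m)%N by rewrite ltn_mod.
  have hch := annihilates_chain x y T hW.
  have iE : (x + i %/ l * l = i)%N by rewrite addnC -divn_eq.
  have jE : (y + (T - i %/ l) * m = j)%N by rewrite /T addKn addnC -divn_eq.
  have lev' : (l * m < m * (x + T * l) + l * y)%N.
    have -> : (m * (x + T * l) + l * y =
        m * (x + i %/ l * l) + l * (y + j %/ m * m))%N by rewrite /T; ring.
    by rewrite iE (addnC y) -divn_eq.
  have [||uT vT] := @chain_slot_inj K l m c x y T m_gt1 le_ml l_gt2 xl ym lev' _ _ hch.
  - rewrite subnn mul0n addn0; case: (y) => [//|y'] sl /=; rewrite WS ?mulr0 //.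
  - rewrite subnn mul0n addn0; case: (x + T * l)%N => [|x'] sl /=; rewrite ?mulr0 //.
    by rewrite WS ?mulr0.
  have iT : (i %/ l <= T)%N by rewrite leq_addr.
  have := chain_det_bot l_gt1 m_gt1 hch uT vT iT.
  rewrite iE jE => -[] /eqP + /eqP.
  have sn a : (- s) ^+ a != 0.
    by apply/eqP => e; have := su2 a; rewrite e mulr0 => /esym/eqP; rewrite oner_eq0.
  by rewrite !mulf_eq0 !(negPf (sn _)) /= => /eqP ? /eqP ?.
case: p => k' [a b]; rewrite memE => /eqP.
case: (I2_cases k') => -> e.
  have [|h _] := key a b.+1; last exact: h.
  by rewrite level_gt // -/g -/ch mulSn; lia.
have [|_ h] := key a.+1 b; last exact: h.
by rewrite level_gt // -/g -/ch mulSn; lia.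
Qed.

(** This function is carried by the points of one chain; the power of [- s] undoes the normalization
    of [annihilates_chain]. *)
Let ext (x y T : nat) (w : nat -> K) (i j : nat) : K :=
  if [&& i %% l == x, j %% m == y & i %/ l + j %/ m == T]%N
  then (- s) ^+ (i %/ l) * w (i %/ l)%N else 0.

(** The points (p, q + m) and (p + l, q) are consecutive on a common chain, so both lie on the chain
    (x, y, T) or neither does. *)
Let ext_shift x y T p q :
  (exists a, [/\ (a < T)%N, p = (x + a * l)%N, q = (y + (T - a.+1) * m)%N &
    forall w, ext x y T w p (q + m) = (- s) ^+ a * w a /\
              ext x y T w (p + l) q = - s * (- s) ^+ a * w a.+1]) \/
  (forall w, ext x y T w p (q + m) = 0 /\ ext x y T w (p + l) q = 0).
Proof.
have m0 : (0 < m)%N by apply: ltnW.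
have l0 : (0 < l)%N by apply: ltnW.
rewrite /ext !modnDr !divnDr // !divnn l0 m0 !addn1.
rewrite addnS addSn.
case: (boolP [&& p %% l == x, q %% m == y & (p %/ l + q %/ m).+1 == T]%N);
  last by right.
move=> /and3P[/eqP <- /eqP <- /eqP <-]; left; exists (p %/ l)%N.
split=> [||| w]; last by rewrite -exprS.
- by rewrite ltnS leq_addr.
- by rewrite addnC -divn_eq.
- by rewrite subSS addKn addnC -divn_eq.
Qed.

Let ext_top x y T q :
  [/\ x.+1 = l, q = (y + T * m)%N & forall w, ext x y T w (l - 1) q = w 0%N] \/
  (forall w, ext x y T w (l - 1) q = 0).
Proof.
have l1 : (l - 1 < l)%N by rewrite ltn_subrL; lia.
rewrite /ext modn_small // divn_small // add0n.
case: (boolP [&& l - 1 == x, q %% m == y & q %/ m == T]%N); last by right.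
move=> /and3P[/eqP <- /eqP <- /eqP <-]; left; split=> [||w]; last by rewrite expr0 mul1r.
  by lia.
by rewrite addnC -divn_eq.
Qed.

Let ext_bot x y T p :
  [/\ y.+1 = m, p = (x + T * l)%N &
    forall w, ext x y T w p (m - 1) = (- s) ^+ T * w T] \/
  (forall w, ext x y T w p (m - 1) = 0).
Proof.
have m1 : (m - 1 < m)%N by rewrite ltn_subrL; lia.
rewrite /ext (modn_small m1) (divn_small m1) addn0.
case: (boolP [&& p %% l == x, m - 1 == y & p %/ l == T]%N); last by right.
move=> /and3P[/eqP <- /eqP <- /eqP <-]; left; split=> [||w] //; first by lia.
by rewrite addnC -divn_eq.
Qed.

Let extension (x y T : nat) (u v : nat -> K) (p : position) : K :=
  if p.1 == c1 then ext x y T u p.2.1 p.2.2.+1 else ext x y T v p.2.1.+1 p.2.2.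

Let extension_annihilates x y T u v : chain l m x y T u v ->
  annihilates (extension x y T u v).
Proof.
move=> hch; split=> p q; rewrite /extension /=.
  have -> : (q + (m - 1)).+1 = (q + m)%N by lia.
  have -> : q%:R * ext x y T u (p + (l - 1)) q.-1.+1 =
      q%:R * ext x y T u (p + (l - 1)) q by case: (q) => [|?]; rewrite ?mul0r.
  case: p => [|p].
    rewrite !add0n mulr0 mul0r add0r.
    have -> : (l - 2).+1 = (l - 1)%N by lia.
    case: (ext_top x y T q) => [[xl1 -> e]|e]; rewrite !e ?mulr0 //.
    exact: chain_top hch xl1.
  have -> : (p.+1 + (l - 2)).+1 = (p + l)%N by lia.
  have -> : (p.+1 + (l - 1) = p + l)%N by lia.
  case: (ext_shift x y T p q) => [[a [aT ep eq e]]|e]; last first.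
    by have [-> ->] := e u; have [_ ->] := e v; rewrite !mulr0 addr0.
  have [-> ->] := e u; have [_ ->] := e v.
  have := chain_u hch aT; rewrite -ep -eq addn1 => ch1.
  have -> : q%:R * (- s * (- s) ^+ a * u a.+1) = - s * (- s) ^+ a * (q%:R * u a.+1).
    by ring.
  by rewrite ch1; ring.
have -> : s * p%:R * ext x y T v p.-1.+1 (q + (m - 1)) =
    s * p%:R * ext x y T v p (q + (m - 1)).
  by case: (p) => [|?]; rewrite ?mulr0 ?mul0r.
case: q => [|q].
  rewrite !add0n mul0r addr0; have -> : (m - 2).+1 = (m - 1)%N by lia.
  case: (ext_bot x y T p) => [[ym1 -> e]|e]; rewrite !e ?mulr0 //.
  have -> : s * (x + T * l)%:R * ((- s) ^+ T * v T) =
    s * (- s) ^+ T * ((x + T * l)%:R * v T) by ring.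
  by rewrite (chain_bot hch ym1); ring.
have -> : (q.+1 + (m - 2)).+1 = (q + m)%N by lia.
have -> : (q.+1 + (m - 1) = q + m)%N by lia.
have -> : (p + (l - 1)).+1 = (p + l)%N by lia.
case: (ext_shift x y T p q) => [[a [aT ep eq e]]|e]; last first.
  by have [-> ->] := e v; have [-> _] := e u; rewrite !mulr0 addr0.
have [-> ->] := e v; have [-> _] := e u.
have := chain_v hch aT; rewrite -ep -eq addn1 => ch2 /=.
have -> : q.+1%:R * (- s * (- s) ^+ a * v a.+1) = - s * (- s) ^+ a * (q.+1%:R * v a.+1).
  by ring.
by rewrite ch2; ring.
Qed.

Lemma annihilates_dual p : slot l m c p -> exists W, annihilates W /\
  forall p', slot l m c p' -> W p' = (p' == p)%:R.
Proof.
have m0 : (0 < m)%N by apply: ltnW.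
have l0 : (0 < l)%N by apply: ltnW.
have sn a : (- s) ^+ a != 0.
  by apply/eqP => e; have := su2 a; rewrite e mulr0 => /esym/eqP; rewrite oner_eq0.
(* A slot has j < m, so it can only be the bottom of its chain; a functional carried by one chain
   sees at most the two slots there. *)
have ext_small w i j i' j' : (j < m)%N -> (j' < m)%N ->
    ext (i %% l) j (i %/ l) w i' j' =
    if (i' == i) && (j' == j) then (- s) ^+ (i %/ l) * w (i %/ l)%N else 0.
  move=> jm jm'; rewrite /ext (modn_small jm') (divn_small jm') addn0.
  case: (eqVneq i' i) => [->|ne] /=; first by rewrite !eqxx andbT.
  case: ifP => // /and3P[/eqP e1 _ /eqP e2]; case/eqP: ne.
  by rewrite (divn_eq i' l) e1 e2 -divn_eq.
have sj1 i j : slot1 l m c i j -> (j < m)%N by case/and3P=> /andP[].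
have sj2 i j : slot2 l m c i j -> (j < m)%N by case/and3P.
case: p => k [i j]; rewrite /slot /=; case: (I2_cases k) => -> /= sl.
  have jm := sj1 _ _ sl.
  (* The bottom value is prescribed as (- s)^T, with T = i %/ l, so that the same factor in [ext]
     turns it into 1. *)
  have [||u [v [hch uT vT]]] := @chain_slot_surj K l m c (i %% l) j.+1 (i %/ l)
    m_gt1 le_ml l_gt2 _ jm _ ((- s) ^+ (i %/ l)) 0.
  - by rewrite ltn_mod.
  - by rewrite (addnC (i %% l)%N) -divn_eq; case/and3P: sl.
  exists (extension (i %% l) j.+1 (i %/ l) u v); split.
    exact: extension_annihilates.
  rewrite (addnC (i %% l)%N) -divn_eq in uT vT.
  case=> k' [i' j']; rewrite /extension /=; case: (I2_cases k') => -> /= sl'.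
    rewrite ext_small // ?(sj1 _ _ sl') // ?xpair_eqE /= ?eqSS.
    by case: ifP => // _; rewrite uT // su2.
  rewrite ext_small // ?(sj2 _ _ sl') // ?xpair_eqE /=.
  case: ifP => // /andP[/eqP e1 /eqP e2].
  by rewrite vT ?mulr0 // -e1 -e2.
have jm := sj2 _ _ sl.
have [||u [v [hch uT vT]]] := @chain_slot_surj K l m c (i.+1 %% l) j (i.+1 %/ l)
  m_gt1 le_ml l_gt2 _ jm _ 0 ((- s) ^+ (i.+1 %/ l)).
- by rewrite ltn_mod.
- by rewrite (addnC (i.+1 %% l)%N) -divn_eq; case/and3P: sl.
exists (extension (i.+1 %% l) j (i.+1 %/ l) u v); split.
  exact: extension_annihilates.
rewrite (addnC (i.+1 %% l)%N) -divn_eq in uT vT.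
case=> k' [i' j']; rewrite /extension /=; case: (I2_cases k') => -> /= sl'.
  rewrite ext_small // ?(sj1 _ _ sl') // ?xpair_eqE /=.
  case: ifP => // /andP[/eqP e1 /eqP e2].
  by rewrite uT ?mulr0 // -e1 -e2.
rewrite ext_small // ?(sj2 _ _ sl') // ?xpair_eqE /= ?eqSS.
by case: ifP => // _; rewrite vT // su2.
Qed.

End Functional.

Section Linearity.
Context (K : fieldType) (n : nat) (d : 'I_n -> K).
Implicit Types (f : series K).

Lemma smul_sumr f (h : 'I_n -> series K) a b :
  smul f (fun a b => \sum_j d j * h j a b) a b = \sum_j d j * smul f (h j) a b.
Proof.
symmetry; rewrite /smul; under eq_bigr => j _ do rewrite mulr_sumr.
rewrite exchange_big; apply: eq_bigr => i _.
under eq_bigr => j _ do rewrite mulr_sumr.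
rewrite exchange_big; apply: eq_bigr => k _.
by rewrite mulr_sumr; apply: eq_bigr => j _; rewrite mulrCA.
Qed.

Lemma smul_suml f (h : 'I_n -> series K) a b :
  smul (fun a b => \sum_j d j * h j a b) f a b = \sum_j d j * smul (h j) f a b.
Proof.
symmetry; rewrite /smul; under eq_bigr => j _ do rewrite mulr_sumr.
rewrite exchange_big; apply: eq_bigr => i _.
under eq_bigr => j _ do rewrite mulr_sumr.
rewrite exchange_big; apply: eq_bigr => k _.
by rewrite mulr_suml; apply: eq_bigr => j _; rewrite mulrA.
Qed.

Lemma spartial_sum i (h : 'I_n -> series K) :
  spartial i (fun a b => \sum_j d j * h j a b) =
  fun a b => \sum_j d j * spartial i (h j) a b.
Proof.
apply/funext => a; apply/funext => b; rewrite /spartial.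
by case: ifP => _; rewrite -sumrMnl; apply: eq_bigr => j _; rewrite mulrnAr.
Qed.

Lemma bracket_sum (P : vseries K) (Q : 'I_n -> vseries K) i a b :
  bracket P (fun i a b => \sum_j d j * Q j i a b) i a b =
  \sum_j d j * bracket P (Q j) i a b.
Proof.
rewrite /bracket !vapplyE /sadd !spartial_sum !smul_sumr !smul_suml -!big_split /=.
rewrite -sumrB; apply: eq_bigr => j _.
by rewrite !vapplyE /sadd mulrBr !mulrDr.
Qed.

End Linearity.

(** * The resonant set and the homological equation *)

Section Resonance.
Context (K : numFieldType) (l m : nat) (minus : bool) (c : choices).
Context (m_gt1 : (1 < m)%N) (le_ml : (m <= l)%N) (l_gt2 : (2 < l)%N).

Let g := weight l m.
Let ch := chi l m.
Let H := unperturbed K l m minus.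
Let g1 : (0 < g c1)%N. Proof. exact: weight1_gt0. Qed.
Let g2 : (0 < g c2)%N. Proof. exact: weight2_gt0. Qed.

Let M k := homological_mx g ch H k.
Let Sk k : pred 'I_(qhdim g (k + ch)) := fun q => slot l m c (qhbasis_nth q).

Lemma slot_inj k : (0 < k)%N -> forall w : 'rV[K]_(qhdim g (k + ch)),
  w *m (M k)^T = 0 -> (forall q, Sk q -> w 0 q = 0) -> w = 0.
Proof.
move=> k_gt0 w wM wS.
pose W p : K := \sum_j w 0 j * (p == qhbasis_nth j)%:R.
have Ww q : W (qhbasis_nth q) = w 0 q.
  rewrite /W (bigD1 q) //= eqxx mulr1 big1 ?addr0 // => j jq.
  by rewrite (inj_eq (@qhbasis_nth_inj _ _)) eq_sym (negPf jq) mulr0.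
have W0 p : p \notin qhbasis g (k + ch) -> W p = 0.
  move=> np; apply: big1 => j _; case: eqP => [e|]; last by rewrite mulr0.
  by rewrite e mem_qhbasis_nth in np.
have rW : \row_q W (qhbasis_nth q) = w by apply/rowP => q; rewrite !mxE.
have hW : annihilates l m minus W.
  by apply: (mx_annihilates m_gt1 le_ml l_gt2 (k := k)) => //; rewrite rW.
apply/rowP => q; rewrite mxE -Ww.
apply: (annihilates_inj (c := c) m_gt1 le_ml l_gt2 k_gt0 hW W0) => p sp.
case: (boolP (p \in qhbasis g (k + ch))) => [/qhbasis_nthP[j ej]|/W0 //].
by rewrite -ej Ww wS // /Sk ej.
Qed.

Lemma slot_dual k q : Sk q -> exists w : 'rV[K]_(qhdim g (k + ch)),
  w *m (M k)^T = 0 /\ forall q', Sk q' -> w 0 q' = (q' == q)%:R.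
Proof.
move=> /(annihilates_dual K minus m_gt1 le_ml l_gt2) [W [hW WS]].
exists (\row_q W (qhbasis_nth q)); split; first exact: annihilates_mx.
by move=> q' sq'; rewrite mxE WS // (inj_eq (@qhbasis_nth_inj _ _)).
Qed.

Lemma remaining_resonant : resonant_set g ch H (remaining l m c).
Proof.
split=> [p /(remainingP c m_gt1 le_ml l_gt2)|k k_gt0].
  case: p => i [a b]; rewrite /slot /=; case: (I2_cases i) => -> /= /and3P[_].
    rewrite level_gt // -/g -/ch mulSn => lev _.
    exists (a * g c1 + b * g c2 - ch - g c1)%N; first by lia.
    by rewrite qhbasisE // /gdegree /=; lia.
  rewrite level_gt // -/g -/ch mulSn => lev _.
  exists (a * g c1 + b * g c2 - ch - g c2)%N; first by lia.
  by rewrite qhbasisE // /gdegree /=; lia.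
have [t [tS tA]] := resonant_minor (slot_inj k_gt0) (@slot_dual k).
exists t; split=> [q|A [Afree AM]]; last by apply: tA => //; rewrite AM.
split=> [/(remainingP c m_gt1 le_ml l_gt2)|]; first by move=> h; apply/tS.
by move=> /tS sq; apply/(remainingP c m_gt1 le_ml l_gt2).
Qed.

(** The rows of [homological_mx] span the image of [H, -], so [rowspace_decomposition] splits the
    degree k + chi part of [R] into a bracket and a vector supported on slots. *)
Lemma homological_solution k (R : position -> K) : (0 < k)%N ->
  exists q w : vseries K,
  [/\ forall p, p \notin qhbasis g k -> coefficient q p = 0,
      forall p, p \notin qhbasis g (k + ch) -> coefficient w p = 0,
      forall p, coefficient w p <> 0 -> remaining l m c p &
      forall p, p \in qhbasis g (k + ch) ->
        R p = coefficient (bracket H q) p + coefficient w p].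
Proof.
move=> k_gt0.
have [d [w [e wS]]] := rowspace_decomposition (slot_inj k_gt0) (\row_j R (qhbasis_nth j)).
pose Q : vseries K := fun i a b =>
  \sum_j d 0 j * coefficient (monomial_field K (qhbasis_nth j)) (i, (a, b)).
pose Y : vseries K := fun i a b => \sum_j w 0 j * ((i, (a, b)) == qhbasis_nth j)%:R.
exists Q, Y; split.
- move=> [i [a b]] np; apply: big1 => j _.
  rewrite /coefficient /monomial_field /=; case: eqP => [ei|]; last by rewrite mulr0.
  rewrite (smonomialE _ _ _ (a, b)) -surjective_pairing.
  case: eqP => [ea|]; last by rewrite !mulr0.
  by move: np; rewrite ei ea -surjective_pairing mem_qhbasis_nth.
- move=> [i [a b]] np; apply: big1 => j _; case: eqP => [ep|]; last by rewrite mulr0.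
  by rewrite ep mem_qhbasis_nth in np.
- move=> [i [a b]]; rewrite /coefficient /= => Yp.
  case: (boolP (slot l m c (i, (a, b)))) => [/(remainingP c m_gt1 le_ml l_gt2) //|ns].
  case: Yp; apply: big1 => j _; case: eqP => [ep|]; last by rewrite mulr0.
  by rewrite wS ?mul0r // /Sk -ep.
move=> p /qhbasis_nthP[j <-].
have /rowP/(_ j) := e; rewrite !mxE => ->; congr (_ + _).
  by rewrite /coefficient bracket_sum; apply: eq_bigr => k' _; rewrite !mxE.
rewrite /coefficient /Y -!surjective_pairing (bigD1 j) //= eqxx mulr1.
rewrite big1 ?addr0 // => i ij.
by rewrite (inj_eq (@qhbasis_nth_inj _ _)) eq_sym (negPf ij) mulr0.
Qed.

End Resonance.

(** * Composition and brackets modulo higher order *)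

Section SeriesAlgebra.
Context (K : fieldType).
Implicit Types (f h : series K) (P Q : vseries K).

Lemma smulC f h : smul f h = smul h f.
Proof.
apply/funext => a; apply/funext => b; rewrite /smul.
rewrite (reindex_inj rev_ord_inj); apply: eq_bigr => i _.
rewrite (reindex_inj rev_ord_inj); apply: eq_bigr => j _.
by rewrite mulrC /= !subSS !subKn ?leq_ord.
Qed.

Lemma smulDl f f' h : smul (sadd f f') h = sadd (smul f h) (smul f' h).
Proof.
apply/funext => a; apply/funext => b; rewrite /smul /sadd -big_split.
apply: eq_bigr => i _; rewrite -big_split; apply: eq_bigr => j _.
by rewrite mulrDl.
Qed.

Lemma smulDr f h h' : smul f (sadd h h') = sadd (smul f h) (smul f h').
Proof. by rewrite smulC smulDl !(smulC f). Qed.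

Lemma saddA f h k : sadd f (sadd h k) = sadd (sadd f h) k.
Proof. by apply/funext => a; apply/funext => b; rewrite /sadd addrA. Qed.

Lemma smul1l f : smul (smonomial 1 0 0) f = f.
Proof.
by apply/funext => a; apply/funext => b; rewrite smul_monomial /= mul1r !subn0.
Qed.

Lemma smul1r f : smul f (smonomial 1 0 0) = f.
Proof. by rewrite smulC smul1l. Qed.

Lemma smul_monomialA (c c' : K) p q p' q' f :
  smul (smonomial c p q) (smul (smonomial c' p' q') f) =
  smul (smonomial (c * c') (p + p') (q + q')) f.
Proof.
apply/funext => a; apply/funext => b; rewrite !smul_monomial.
case: ifP => [/andP[pa qb]|pq]; last first.
  case: ifP => // /andP[pa qb].
  by rewrite (leq_trans (leq_addr _ _) pa) (leq_trans (leq_addr _ _) qb) in pq.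
rewrite !leq_subRL // !subnDA; case: ifP => _; rewrite ?mulr0 //.
by rewrite mulrA.
Qed.

Lemma smul_monomialD (c c' : K) p q f :
  sadd (smul (smonomial c p q) f) (smul (smonomial c' p q) f) =
  smul (smonomial (c + c') p q) f.
Proof.
rewrite -smulDl; congr smul; apply/funext => a; apply/funext => b.
by rewrite /sadd /smonomial; case: ifP; rewrite ?addr0.
Qed.

Lemma spartialD i f h : spartial i (sadd f h) = sadd (spartial i f) (spartial i h).
Proof.
apply/funext => a; apply/funext => b; rewrite /spartial /sadd.
by case: ifP => _; rewrite mulrnDl.
Qed.

Lemma vapplyDl P Q f : vapply (vadd P Q) f = sadd (vapply P f) (vapply Q f).
Proof.
rewrite !vapplyE /vadd !smulDl; apply/funext => a; apply/funext => b.
by rewrite /sadd addrACA.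
Qed.

Lemma vapplyDr P f h : vapply P (sadd f h) = sadd (vapply P f) (vapply P h).
Proof.
rewrite !vapplyE !spartialD !smulDr; apply/funext => a; apply/funext => b.
by rewrite /sadd addrACA.
Qed.

Lemma vapply_identity P i : vapply P (videntity K i) = P i.
Proof.
rewrite vapplyE /videntity; case: (I2_cases i) => -> /=;
  rewrite !spartial_monomial /= mulr1n mulr0n smonomial0 smul0r smul1r;
  by apply/funext => a; apply/funext => b; rewrite /sadd ?addr0 ?add0r.
Qed.

Lemma scompD f h x a b : scomp (sadd f h) x a b = scomp f x a b + scomp h x a b.
Proof.
rewrite /scomp -big_split; apply: eq_bigr => p _.
by rewrite -big_split; apply: eq_bigr => q _; rewrite mulrDl.
Qed.

Lemma spow_monomial (p q n : nat) :
  spow (smonomial (1 : K) p q) n = smonomial 1 (n * p) (n * q).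
Proof.
by elim: n => [//|n IH]; rewrite /spow iterS -/(spow _ _) IH smul_monomials mulr1 !mulSn.
Qed.

Lemma spowS f n : spow f n.+1 = smul f (spow f n).
Proof. by []. Qed.

End SeriesAlgebra.

Section Congruence.
Context (K : fieldType) (g : 'I_2 -> nat).
Implicit Types (f h : series K) (P Q : vseries K).

Definition eqm (n : nat) f h : Prop :=
  forall a b, (gdegree g (a, b) < n)%N -> f a b = h a b.

(** Degrees are those of scalar monomials: [ord_ge g P n] amounts to [sord (P i) (n + g i)] for both
    i. *)
Definition sord f n : Prop := forall a b, (gdegree g (a, b) < n)%N -> f a b = 0.

Let gdegree_split a b i j : (i <= a)%N -> (j <= b)%N ->
  gdegree g (a, b) = (gdegree g (i, j) + gdegree g (a - i, b - j))%N.
Proof.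
move=> ia jb; rewrite /gdegree /= !mulnBl.
have : (i * g c1 <= a * g c1)%N by rewrite leq_mul2r ia orbT.
have : (j * g c2 <= b * g c2)%N by rewrite leq_mul2r jb orbT.
lia.
Qed.

Lemma eqm_trans n f h k : eqm n f h -> eqm n h k -> eqm n f k.
Proof. by move=> e1 e2 a b ab; rewrite e1 // e2. Qed.

Lemma eqm_le n n' f h : (n' <= n)%N -> eqm n f h -> eqm n' f h.
Proof. by move=> le e a b ab; rewrite e // (leq_trans ab). Qed.

Lemma eqmD n f f' h h' : eqm n f f' -> eqm n h h' -> eqm n (sadd f h) (sadd f' h').
Proof. by move=> e1 e2 a b ab; rewrite /sadd e1 // e2. Qed.

Lemma eqm_sadd0 n f h : sord h n -> eqm n (sadd f h) f.
Proof. by move=> h0 a b ab; rewrite /sadd h0 // addr0. Qed.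

Lemma smul_eqm n r f f' h : eqm n f f' -> sord h r ->
  eqm (n + r) (smul f h) (smul f' h).
Proof.
move=> e h0 a b ab; apply: eq_bigr => i _; apply: eq_bigr => j _.
case: (ltnP (gdegree g (i : nat, j : nat)) n) => [lt|ge]; first by rewrite e.
rewrite h0 ?mulr0 //; move: ab.
by rewrite (@gdegree_split a b i j) ?leq_ord //; lia.
Qed.

Lemma smul_eqmr n r f f' h : eqm n f f' -> sord h r ->
  eqm (r + n) (smul h f) (smul h f').
Proof. by move=> e h0; rewrite !(smulC h) addnC; apply: smul_eqm. Qed.

Lemma smul_sord n r f h : sord f n -> sord h r -> sord (smul f h) (n + r).
Proof.
by move=> f0 h0; have := smul_eqm f0 h0; rewrite smul0l.
Qed.

Lemma smonomial_sord c p q : sord (smonomial (c : K) p q) (gdegree g (p, q)).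
Proof.
move=> a b; rewrite /smonomial; case: ifP => // /andP[/eqP -> /eqP ->].
by rewrite ltnn.
Qed.

Lemma spow_sord f r n : sord f r -> sord (spow f n) (n * r).
Proof.
move=> f0; elim: n => [|n IH]; first by [].
by rewrite spowS mulSn; apply: smul_sord.
Qed.

Lemma spow_eqm f f' r k n : sord f r -> eqm (r + k) f f' ->
  eqm (n * r + k) (spow f n) (spow f' n).
Proof.
move=> f0 e; elim: n => [|n IH] //.
have f0' : sord f' r by move=> a b ab; rewrite -e ?f0 // ltn_addr.
rewrite !spowS mulSn; apply: (@eqm_trans _ _ (smul f (spow f' n))).
  by rewrite -addnA; apply: smul_eqmr.
rewrite addnAC; apply: smul_eqm => //; exact: spow_sord.
Qed.

(** This is a first-order expansion in d with derivative (n+1) e^n: replacing f by its leading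
    monomial e costs terms one degree higher, and terms quadratic in d gain k >= 1 further
    degrees. *)
Lemma spow_linear f d p q k n : let e := smonomial 1 p q in
  let r := gdegree g (p, q) in
  (0 < k)%N -> eqm (r + 1) f e -> sord d (r + k) ->
  eqm (n.+1 * r + k + 1) (spow (sadd f d) n.+1)
    (sadd (spow f n.+1) (smul (smonomial n.+1%:R (n * p) (n * q)) d)).
Proof.
move=> e r k_gt0 fe d0.
have e0 : sord e r by apply: smonomial_sord.
have f0 : sord f r by move=> a b ab; rewrite fe ?e0 // ltn_addr.
have fde : eqm (r + 1) (sadd f d) e.
  move=> a b ab; rewrite /sadd fe // d0 ?addr0 //.
  by rewrite (leq_trans ab) // leq_add2l.
elim: n => [|n IH].
  by rewrite /spow /= !smul1r smul1l.
rewrite spowS smulDl.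
set L := smul (smonomial n.+1%:R (n * p) (n * q)) d in IH *.
have L0 : sord L (n * r + (r + k)).
  apply: smul_sord => //; have -> : (n * r = gdegree g (n * p, n * q))%N.
    by rewrite /r /gdegree /= mulnDr !mulnA.
  exact: smonomial_sord.
have h1 : eqm (n.+2 * r + k + 1) (smul f (spow (sadd f d) n.+1))
    (sadd (spow f n.+2) (smul e L)).
  apply: (@eqm_trans _ _ (smul f (sadd (spow f n.+1) L))).
    have -> : (n.+2 * r + k + 1 = r + (n.+1 * r + k + 1))%N by rewrite (mulSn n.+1); lia.
    exact: smul_eqmr.
  rewrite smulDr -spowS; apply: eqmD => //.
  have -> : (n.+2 * r + k + 1 = r + 1 + (n * r + (r + k)))%N by rewrite !mulSn; lia.
  exact: smul_eqm.
have h2 : eqm (n.+2 * r + k + 1) (smul d (spow (sadd f d) n.+1))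
    (smul (spow e n.+1) d).
  rewrite (smulC _ d).
  have -> : (n.+2 * r + k + 1 = (r + k) + (n.+1 * r + 1))%N by rewrite (mulSn n.+1); lia.
  apply: smul_eqmr => //.
  apply: spow_eqm => //.
  by move=> a b ab; rewrite fde ?e0 // ltn_addr.
have := eqmD h1 h2; rewrite -saddA; congr (eqm _ _ (sadd _ _)).
rewrite /L /e smul_monomialA mul1r spow_monomial -!mulSn smul_monomialD.
by rewrite natr1.
Qed.

(** The weight [g k] lost by [spartial k] is regained in the factor [P k]. *)
Lemma vapply_sord P f n r : ord_ge g P n -> sord f r -> sord (vapply P f) (n + r).
Proof.
move=> P0 f0 a b ab; apply: big1 => k _; apply: big1 => i _; apply: big1 => j _.
case: (ltnP (gdegree g (i : nat, j : nat)) (n + g k)) => [lt|].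
  by rewrite P0 ?mul0r.
move: ab; rewrite (@gdegree_split a b i j) ?leq_ord // /spartial.
case: (I2_cases k) => -> /= ab le; rewrite f0 ?mul0rn ?mulr0 //.
  by move: ab le; rewrite /gdegree /= mulSn; lia.
by move: ab le; rewrite /gdegree /= mulSn; lia.
Qed.

End Congruence.

Section Composition.
Context (K : fieldType).
Implicit Types (f h : series K) (x : vseries K).

Lemma scomp_monomial (c : K) p q x a b : (forall i, x i 0%N 0%N = 0) ->
  scomp (smonomial c p q) x a b = c * smul (spow (x c1) p) (spow (x c2) q) a b.
Proof.
move=> x0.
(* With both weights 1, every component of x has order at least 1, so exponents beyond the finite
   range of [scomp] contribute nothing at (a, b). *)
pose t : 'I_2 -> nat := fun _ => 1%N.
have xt i : sord t (x i) 1.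
  move=> a' b'; rewrite /gdegree /= !muln1 ltnS leqn0 addn_eq0.
  by move=> /andP[/eqP -> /eqP ->].
have pq0 : (a + b < p + q)%N -> smul (spow (x c1) p) (spow (x c2) q) a b = 0.
  move=> lt; have := smul_sord (spow_sord (n := p) (xt c1)) (spow_sord (n := q) (xt c2)).
  by apply; rewrite /gdegree /= !muln1.
rewrite /scomp /smonomial.
case: (ltnP p (a + b).+1) => [pa|pa]; last first.
  rewrite pq0 ?(leq_trans pa) ?leq_addr // mulr0; apply: big1 => i _.
  apply: big1 => j _; case: eqP => [ip|_]; last by rewrite mul0r.
  by move: pa; rewrite -ip leqNgt ltn_ord.
case: (ltnP q (a + b).+1) => [qa|qa]; last first.
  rewrite pq0 ?(leq_trans qa) ?leq_addl // mulr0; apply: big1 => i _.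
  apply: big1 => j _; case: (nat_of_ord j =P q) => [jq|_]; last by rewrite andbF mul0r.
  by move: qa; rewrite -jq leqNgt ltn_ord.
rewrite (bigD1 (Ordinal pa)) //= (bigD1 (Ordinal qa)) //= !eqxx.
rewrite !big1 ?addr0 // => [i ne|j ne].
  by apply: big1 => j _; rewrite -val_eqE /= in ne; rewrite (negPf ne) mul0r.
by rewrite -val_eqE /= in ne; rewrite (negPf ne) mul0r.
Qed.

(** A monomial of degree N >= n becomes a series of order N, and changing x by relative order k
    alters it only from degree N + k on. *)
Lemma scomp_eqm (g : 'I_2 -> nat) f x x' n k : sord g f n ->
  (forall i, sord g (x i) (g i)) -> (forall i, eqm g (g i + k) (x i) (x' i)) ->
  eqm g (n + k) (scomp f x) (scomp f x').
Proof.
move=> f0 x0 e a b ab; apply: eq_bigr => p _; apply: eq_bigr => q _.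
case: (ltnP (gdegree g (p : nat, q : nat)) n) => [lt|le].
  by rewrite f0 // !mul0r.
congr (_ * _).
have x0' i : sord g (x' i) (g i) by move=> a' b' ab'; rewrite -e ?x0 // ltn_addr.
suff: eqm g (p * g c1 + q * g c2 + k) (smul (spow (x c1) p) (spow (x c2) q))
    (smul (spow (x' c1) p) (spow (x' c2) q)).
  by apply; rewrite (leq_trans ab) // leq_add2r.
apply: (@eqm_trans _ _ _ _ (smul (spow (x' c1) p) (spow (x c2) q))).
  rewrite addnAC; apply: smul_eqm; [exact: spow_eqm | exact: spow_sord].
by rewrite -addnA; apply: smul_eqmr; [exact: spow_eqm | exact: spow_sord].
Qed.

End Composition.

(** * Change of the residual in one step *)

Section Residual.
Context (K : fieldType) (l m : nat) (minus : bool).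
Context (m_gt1 : (1 < m)%N) (le_ml : (m <= l)%N) (l_gt2 : (2 < l)%N).

Let g := weight l m.
Let ch := chi l m.
Let H := unperturbed K l m minus.
Let g1 : (0 < g c1)%N. Proof. exact: weight1_gt0. Qed.
Let g2 : (0 < g c2)%N. Proof. exact: weight2_gt0. Qed.
Let lg : (l * g c1 = ch + g c1 + g c2)%N. Proof. exact: weight_l. Qed.
Let mg : (m * g c2 = ch + g c1 + g c2)%N. Proof. exact: weight_m. Qed.

Definition residual (F Q G : vseries K) : vseries K := fun i a b =>
  scomp (F i) (vadd (videntity K) Q) a b - vapply G (vadd (videntity K) Q i) a b.

Let gd1 n : gdegree g (n, 0%N) = (n * g c1)%N.
Proof. by rewrite /gdegree /= mul0n addn0. Qed.

Let gd2 n : gdegree g (0%N, n) = (n * g c2)%N.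
Proof. by rewrite /gdegree. Qed.

Let gdl : gdegree g (l - 1, 0)%N = (ch + g c2)%N.
Proof. by rewrite gd1 mulnBl lg; lia. Qed.

Let gdm : gdegree g (0, m - 1)%N = (ch + g c1)%N.
Proof. by rewrite gd2 mulnBl mg; lia. Qed.

Lemma videntity_sord i : sord g (videntity K i) (g i).
Proof.
case: (I2_cases i) => ->; rewrite /videntity /=.
  by have := @smonomial_sord K g 1 1 0; rewrite gd1 mul1n.
by have := @smonomial_sord K g 1 0 1; rewrite gd2 mul1n.
Qed.

Lemma unperturbed_ord : ord_ge g H ch.
Proof.
move=> i; rewrite /H /unperturbed; case: (I2_cases i) => -> /=.
  by rewrite -gdm; apply: smonomial_sord.
by rewrite -gdl; apply: smonomial_sord.
Qed.

Let gd00 i : (gdegree g (0, 0)%N < g i)%N.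
Proof. by rewrite /gdegree /= addn0; case: (I2_cases i) => ->. Qed.

(** Each component of H is a multiple of a pure power, so [spow_linear] applies; the derivative may
    be taken at the identity because x agrees with it to leading order. *)
Lemma scomp_unperturbed x d k i : (0 < k)%N ->
  (forall i, eqm g (g i + 1) (x i) (videntity K i)) -> ord_ge g d k ->
  eqm g (ch + k + 1 + g i) (scomp (H i) (vadd x d))
    (sadd (scomp (H i) x) (vapply d (H i))).
Proof.
move=> k_gt0 xe d0.
have x0 j : sord g (x j) (g j).
  by move=> a b ab; rewrite xe ?videntity_sord // ltn_addr.
have x00 j : x j 0%N 0%N = 0 by rewrite x0.
have xd00 j : vadd x d j 0%N 0%N = 0.
  by rewrite /vadd /sadd x00 add0r d0 // (leq_trans (gd00 j)) // leq_addl.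
move=> a b; rewrite /sadd vapplyE /H /unperturbed.
case: (I2_cases i) => -> /= ab; rewrite !spartial_monomial /= mulr0n smonomial0 smul0r.
  rewrite !scomp_monomial // !smul1l /sadd add0r.
  have [m2 em] : exists m2, m = m2.+2 by exists (m - 2)%N; lia.
  have := @spow_linear K g (x c2) (d c2) 0 1 k m2 k_gt0.
  rewrite gd2 mul1n => /(_ (xe c2)) lin.
  have e : (m - 1 = m2.+1)%N by lia.
  have dk : sord g (d c2) (g c2 + k) by rewrite addnC; apply: d0.
  rewrite e; have := lin dk a b; rewrite /vadd => ->; last first.
    by move: ab; rewrite -e; have := gdm; rewrite gd2 => ->; lia.
  rewrite /sadd mulrDr; congr (_ + _); rewrite muln0 muln1 [in RHS]smulC.
  by rewrite !smul_monomial /=; case: ifP => _; rewrite ?mulr0 // mulrA mulr_natr.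
rewrite !scomp_monomial // !smul1r /sadd addr0 !mul1r.
have [l2 el] : exists l2, l = l2.+2 by exists (l - 2)%N; lia.
have := @spow_linear K g (x c1) (d c1) 1 0 k l2 k_gt0.
rewrite gd1 mul1n => /(_ (xe c1)) lin.
have e : (l - 1 = l2.+1)%N by lia.
have dk : sord g (d c1) (g c1 + k) by rewrite addnC; apply: d0.
rewrite e; have := lin dk a b; rewrite /vadd => ->; last first.
  by move: ab; rewrite -e; have := gdl; rewrite gd1 => ->; lia.
by rewrite /sadd; congr (_ + _); rewrite muln0 muln1 [in RHS]smulC.
Qed.

(** The linear term of H in q is q(H), which combines with H(q) into -[H, q]. Applying w to the
    identity gives w. The rest, X(x + q) - X(x), Y(q), w(q) and w(Q), has order at least chi + k +
    1. *)
Lemma residual_step X Q Y q w k i : (0 < k)%N ->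
  ord_ge g X (ch + 1) -> ord_ge g Q 1 -> ord_ge g Y (ch + 1) ->
  ord_ge g q k -> ord_ge g w (ch + k) ->
  eqm g (ch + k + 1 + g i)
    (residual (vadd H X) (vadd Q q) (vadd H (vadd Y w)) i)
    (fun a b => residual (vadd H X) Q (vadd H Y) i a b - bracket H q i a b - w i a b).
Proof.
move=> k_gt0 X0 Q0 Y0 q0 w0.
pose x := vadd (videntity K) Q.
have xe j : eqm g (g j + 1) (x j) (videntity K j).
  by apply: eqm_sadd0; rewrite addnC; apply: Q0.
have x0 j : sord g (x j) (g j).
  by move=> a b ab; rewrite xe ?videntity_sord // ltn_addr.
have -> : residual (vadd H X) (vadd Q q) (vadd H (vadd Y w)) i = fun a b =>
   scomp (vadd H X i) (vadd x q) a b - vapply (vadd H (vadd Y w)) (vadd x q i) a b.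
  rewrite /residual; have -> // : vadd (videntity K) (vadd Q q) = vadd x q.
  by apply/funext => j; rewrite /x /vadd saddA.
move=> a b ab; rewrite /residual -/x -[vadd H X i]/(sadd (H i) (X i)) !scompD.
rewrite (scomp_unperturbed k_gt0 xe q0 ab).
have <- : scomp (X i) x a b = scomp (X i) (vadd x q) a b.
  apply: (@scomp_eqm K g (X i) x (vadd x q) (ch + 1 + g i) k) => //; first exact: X0.
    by move=> j a' b' ab'; rewrite /vadd /sadd q0 ?addr0 // addnC.
  by move: ab; lia.
rewrite -[vadd x q i]/(sadd (x i) (q i)) !vapplyDl !(vapplyDr _ (x i) (q i)).
rewrite /sadd /bracket.
have -> : vapply Y (q i) a b = 0.
  by apply: (vapply_sord Y0 (q0 i)); move: ab; lia.
have -> : vapply w (q i) a b = 0.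
  by apply: (vapply_sord w0 (q0 i)); move: ab; lia.
have -> : vapply w (x i) a b = w i a b.
  rewrite /x /vadd vapplyDr vapply_identity /sadd.
  by rewrite (vapply_sord w0 (Q0 i)) ?addr0 //; move: ab; lia.
ring.
Qed.
End Residual.

(** * Normalizing transformation *)

Lemma scomp_identity (K : fieldType) (f : series K) : scomp f (videntity K) = f.
Proof.
apply/funext => a; apply/funext => b; rewrite /scomp /videntity /=.
under eq_bigr => p _.
  under eq_bigr => q _ do
    rewrite !spow_monomial smul_monomials !muln0 !muln1 add0n addn0 mulr1.
  over.
have pa : (a < (a + b).+1)%N by rewrite ltnS leq_addr.
have qb : (b < (a + b).+1)%N by rewrite ltnS leq_addl.
rewrite (bigD1 (Ordinal pa)) //= (bigD1 (Ordinal qb)) //= /smonomial !eqxx mulr1.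
rewrite !big1 ?addr0 // => [i ne|j ne].
  apply: big1 => j _; rewrite -val_eqE /= eq_sym in ne.
  by rewrite (negPf ne) mulr0.
by rewrite -val_eqE /= eq_sym in ne; rewrite (negPf ne) andbF mulr0.
Qed.

Section NormalForm.
Context (K : numFieldType) (l m : nat) (minus : bool) (c : choices).
Context (m_gt1 : (1 < m)%N) (le_ml : (m <= l)%N) (l_gt2 : (2 < l)%N).

Let g := weight l m.
Let ch := chi l m.
Let H := unperturbed K l m minus.
Let g1 : (0 < g c1)%N. Proof. exact: weight1_gt0. Qed.
Let g2 : (0 < g c2)%N. Proof. exact: weight2_gt0. Qed.

Context (X : vseries K) (X0 : ord_ge g X (ch + 1)).

Let res (P : vseries K * vseries K) := residual (vadd H X) P.1 (vadd H P.2).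

(** The index starts at 1: for Q = Y = 0 the residual is X itself, of order chi + 1. *)
Record approximation (k : nat) (P : vseries K * vseries K) : Prop := Approximation {
  approx_Q : ord_ge g P.1 1;
  approx_Y : ord_ge g P.2 (ch + 1);
  approx_remaining : forall p, coefficient P.2 p <> 0 -> remaining l m c p;
  approx_residual : ord_ge g (res P) (ch + k)
}.

Let zero : vseries K * vseries K := (fun _ _ _ => 0, fun _ _ _ => 0).

Let approximation0 : approximation 1 zero.
Proof.
split=> // i a b ab; rewrite /res /residual.
have -> : vadd (videntity K) zero.1 = videntity K.
  by apply/funext => j; apply/funext => a'; apply/funext => b'; rewrite /vadd /sadd addr0.
rewrite vapply_identity scomp_identity /vadd /sadd addr0.
by rewrite (X0 ab) addr0 subrr.
Qed.

Let bracket_ord k q : ord_ge g q k -> ord_ge g (bracket H q) (ch + k).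
Proof.
move=> q0 i a b ab; rewrite /bracket.
have H0 := unperturbed_ord K minus m_gt1 le_ml l_gt2.
rewrite (vapply_sord H0 (q0 i)); last by rewrite addnA.
rewrite (vapply_sord q0 (H0 i)) ?subr0 //.
by rewrite addnA (addnC k).
Qed.

Let next k P : (0 < k)%N -> approximation k P -> exists P',
  [/\ approximation k.+1 P',
      forall i, eqm g (k + g i) (P.1 i) (P'.1 i) &
      forall i, eqm g (ch + k + g i) (P.2 i) (P'.2 i)].
Proof.
move=> k_gt0 [Q0 Y0 Yr R0].
have [q [w [qs ws wr hs]]] := homological_solution (K := K) minus c m_gt1 le_ml l_gt2
  (coefficient (res P)) k_gt0.
have q0 : ord_ge g q k.
  move=> i a b ab; apply: (qs (i, (a, b))).
  by rewrite qhbasisE // neq_ltn ab.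
have w0 : ord_ge g w (ch + k).
  move=> i a b ab; apply: (ws (i, (a, b))).
  by rewrite qhbasisE // neq_ltn addnC (addnC k) addnC ab.
exists (vadd P.1 q, vadd P.2 w); split=> /=.
- split=> /=.
  + move=> i a b ab; rewrite /vadd /sadd Q0 // q0 ?addr0 // (leq_trans ab) //.
    by rewrite leq_add2r.
  + move=> i a b ab; rewrite /vadd /sadd Y0 // w0 ?addr0 // (leq_trans ab) //.
    by rewrite leq_add2r leq_add2l.
  + move=> [i [a b]]; rewrite /coefficient /vadd /sadd /= => nz.
    case: (eqVneq (w i a b) 0) => [e|/eqP]; last exact: (wr (i, (a, b))).
    by rewrite e addr0 in nz; apply: (Yr (i, (a, b))).
  + move=> i a b ab; rewrite /res /=.
    have -> // :=
      @residual_step K l m minus m_gt1 le_ml l_gt2 X _ _ q w k i k_gt0 X0 Q0 Y0 q0 w0 a b;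
      last by move: ab; rewrite addnS addn1.
    (* Below degree chi + k every term vanishes; in degree chi + k the homological equation cancels
       the residual. *)
    case: (ltnP (gdegree g (a, b)) (ch + k + g i)) => [lt|ge].
      rewrite -/(res P i a b) R0 // (bracket_ord q0) // w0 //.
      by rewrite !subr0.
    have := hs (i, (a, b)); rewrite qhbasisE // /coefficient /= -/(res P i a b) => ->.
      by rewrite addrAC addrK subrr.
    by move: ab ge; rewrite addnS addSn ltnS => h1 h2; rewrite eqn_leq (addnC k) h1 h2.
- by move=> i a b ab; rewrite /vadd /sadd q0 ?addr0.
- by move=> i a b ab; rewrite /vadd /sadd w0 ?addr0.
Qed.

Lemma normal_form_exists : exists Q Y : vseries K,
  [/\ ord_ge g Q 1, ord_ge g Y (ch + 1),
      forall p, coefficient Y p <> 0 -> remaining l m c p &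
      transforms (vadd H X) Q (vadd H Y)].
Proof.
have [F hF] : {F : nat * (vseries K * vseries K) -> vseries K * vseries K &
    forall x, (0 < x.1)%N -> approximation x.1 x.2 ->
    [/\ approximation x.1.+1 (F x),
      forall i, eqm g (x.1 + g i) (x.2.1 i) ((F x).1 i) &
      forall i, eqm g (ch + x.1 + g i) (x.2.2 i) ((F x).2 i)]}.
  apply: (@boolp.choice _ _ (fun x y => (0 < x.1)%N -> approximation x.1 x.2 ->
    [/\ approximation x.1.+1 y,
      forall i, eqm g (x.1 + g i) (x.2.1 i) (y.1 i) &
      forall i, eqm g (ch + x.1 + g i) (x.2.2 i) (y.2 i)])) => -[k P] /=.
  have [[k0 aP]|no] := boolp.pselect ((0 < k)%N /\ approximation k P).
    by have [P' hP'] := next k0 aP; exists P'.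
  by exists P => k0 aP; case: no.
pose S := fix S n := if n is n'.+1 then F (n, S n') else zero.
have SA n : approximation n.+1 (S n).
  by elim: n => [//|n IH]; have [] := hF (n.+1, S n) isT IH.
have SS n : (forall i, eqm g (n.+1 + g i) ((S n).1 i) ((S n.+1).1 i)) /\
    (forall i, eqm g (ch + n.+1 + g i) ((S n).2 i) ((S n.+1).2 i)).
  by have [] := hF (n.+1, S n) isT (SA n).
have S1 n n' i : (n <= n')%N -> eqm g (n.+1 + g i) ((S n).1 i) ((S n').1 i).
  elim: n' => [|n' IH]; first by rewrite leqn0 => /eqP ->.
  rewrite leq_eqVlt => /orP[/eqP -> //|le]; apply: eqm_trans (IH le) _.
  by apply: eqm_le (proj1 (SS n') i); rewrite leq_add2r.
have S2 n n' i : (n <= n')%N -> eqm g (ch + n.+1 + g i) ((S n).2 i) ((S n').2 i).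
  elim: n' => [|n' IH]; first by rewrite leqn0 => /eqP ->.
  rewrite leq_eqVlt => /orP[/eqP -> //|le]; apply: eqm_trans (IH le) _.
  by apply: eqm_le (proj2 (SS n') i); rewrite leq_add2r leq_add2l.
(* Stage n fixes the coefficients of Q in scalar degrees below n + 1 + g_i, so the stage numbered by
   the degree of (a, b) already has the final value there; likewise for Y. *)
pose Q : vseries K := fun i a b => (S (gdegree g (a, b))).1 i a b.
pose Y : vseries K := fun i a b => (S (gdegree g (a, b))).2 i a b.
have SQ n i : eqm g (n.+1 + g i) ((S n).1 i) (Q i).
  move=> a b ab; rewrite /Q; case: (leqP n (gdegree g (a, b))) => [le|/ltnW le].
    exact: S1.
  by rewrite (S1 _ _ i le) // addSn ltnS leq_addr.
have SY n i : eqm g (ch + n.+1 + g i) ((S n).2 i) (Y i).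
  move=> a b ab; rewrite /Y; case: (leqP n (gdegree g (a, b))) => [le|/ltnW le].
    exact: S2.
  by rewrite (S2 _ _ i le) // addnS addSn ltnS addnAC leq_addl.
exists Q, Y; split.
- by move=> i a b ab; rewrite /Q (approx_Q (SA _)).
- by move=> i a b ab; rewrite /Y (approx_Y (SA _)).
- move=> [i [a b]].
  exact: (approx_remaining (SA (gdegree g (a, b))) (p := (i, (a, b)))).
move=> i a b; apply/eqP; rewrite -subr_eq0; apply/eqP.
rewrite -/(residual (vadd H X) Q (vadd H Y) i a b).
set n := gdegree g (a, b).
(* Passing from stage n to the limit adds q and w of orders n + 1 and chi + n + 1, too high to
   affect the residual at (a, b), which vanishes at stage n. *)
pose q : vseries K := fun i a b => Q i a b - (S n).1 i a b.
pose w : vseries K := fun i a b => Y i a b - (S n).2 i a b.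
have q0 : ord_ge g q n.+1 by move=> j a' b' ab; rewrite /q (SQ n) ?subrr.
have w0 : ord_ge g w (ch + n.+1) by move=> j a' b' ab; rewrite /w (SY n) ?subrr.
have -> : Q = vadd (S n).1 q.
  by do 3 apply/funext => ?; rewrite /vadd /sadd addrC subrK.
have -> : Y = vadd (S n).2 w.
  by do 3 apply/funext => ?; rewrite /vadd /sadd addrC subrK.
have [Q0 Y0 _ R0] := SA n.
have lt : (n < ch + n.+1 + g i)%N by rewrite addnS addSn ltnS addnAC leq_addl.
have -> // :=
  @residual_step K l m minus m_gt1 le_ml l_gt2 X _ _ q w n.+1 i isT X0 Q0 Y0 q0 w0 a b;
  last by rewrite -/n addn1 addSn ltnW.
by rewrite -/(res (S n) i a b) R0 // (bracket_ord q0) // w0 // !subr0.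
Qed.

End NormalForm.

Local Close Scope ring_scope.

Theorem corollary4 (R : realType) (K : fieldType) (hK : real_or_complex R K)
    (l m : nat) (hm : (2 <= m)%N) (hlm : (m <= l)%N)
    (hne : ~ (l = 2 /\ m = 2))
    (minus : bool) (c : choices) (hc : admissible l m c) :
  let g := weight l m in
  let H := unperturbed K l m minus in
  resonant_set g (chi l m) H (remaining l m c) /\
  forall X : vseries K, ord_ge g X (chi l m + 1) ->
    exists Q Y : vseries K,
      [/\ ord_ge g Q 1,
          ord_ge g Y (chi l m + 1),
          forall p : position, coefficient Y p <> 0%R -> remaining l m c p
        & transforms (vadd H X) Q (vadd H Y)].
Proof.
have l_gt2 : (2 < l)%N by lia.
(* Real and complex scalars are treated at once: the sign arguments use only the rules for positive
   elements valid in every [numFieldType]. *)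
have main (F : numFieldType) : let H := unperturbed F l m minus in
    resonant_set (weight l m) (chi l m) H (remaining l m c) /\
    forall X : vseries F, ord_ge (weight l m) X (chi l m + 1) ->
    exists Q Y : vseries F,
      [/\ ord_ge (weight l m) Q 1, ord_ge (weight l m) Y (chi l m + 1),
          forall p : position, coefficient Y p <> 0%R -> remaining l m c p
        & transforms (vadd H X) Q (vadd H Y)].
  by split; [exact: remaining_resonant | move=> X; exact: normal_form_exists].
by case: hK; [exact: (main R) | exact: (main R[i]%C)].
Qed.
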